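(* For any graph $G$, the following are equivalent: (a) $G$ is a $(2P_3,C_4,C_6,C_7,T_0)$-free graph that contains an induced 3-pentagon and contains no simplicial vertices; (b) $G$ contains exactly one nontrivial anticomponent, and this anticomponent is a 5-basket, a villa, or a mansion; (c) $G$ can be obtained from a 5-basket, a villa, or a mansion by possibly adding universal vertices to it.
   Context: All graphs are finite, simple, nonnull. A graph is $(H_1,\dots,H_m)$-free if it has no induced subgraph isomorphic to any $H_i$. $P_k$, $C_k$ are the path and cycle on $k$ vertices; $2P_3$ is two disjoint copies of $P_3$. $T_0$ is the graph with vertices $p,q,u_0,u_1,u_2,u_3,w_1,w_2,w_3$ and edges $pq,pu_0,pu_2,pu_3,qu_1,qu_2,qu_3,u_0w_1,u_1w_1,u_2w_2,u_3w_3,w_1w_2,w_1w_3,w_2w_3$. For $t\ge3$ the $t$-pentagon is the graph on vertices $a,b_1,\dots,b_t,c_1,\dots,c_t$ where $a$ is adjacent to every $b_i$ and to no $c_i$, $\{b_1,\dots,b_t\}$ is stable, $\{c_1,\dots,c_t\}$ is a clique, and $b_i c_j$ is an edge iff $i=j$; the 3-pentagon is the case $t=3$. A clique (stable set) is a possibly empty set of pairwise adjacent (nonadjacent) vertices. A vertex is simplicial if its neighbours form a clique, universal if adjacent to all other vertices. For disjoint vertex sets $X,Y$, $X$ is complete (anticomplete) to $Y$ if every vertex of $X$ is adjacent (nonadjacent) to every vertex of $Y$. An anticomponent of $G$ is a maximal induced subgraph whose complement is connected; it is nontrivial if it has at least two vertices. ''$G$ can be obtained from $Q$ by possibly adding universal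 vertices'' means $Q$ is an induced subgraph of $G$ and $V(G)\setminus V(Q)$ is a (possibly empty) clique complete to $V(Q)$. 5-basket: a graph $Q$ whose vertex set partitions into $A,B_1,B_2,B_3,C_1,C_2,C_3,F$ where $A,B_i,C_i$ are nonempty cliques, $F$ is a possibly empty clique, $B_1,B_2,B_3$ are pairwise anticomplete, $C_1,C_2,C_3$ are pairwise complete; there is $i^*\in\{1,2,3\}$ such that $A$ is complete to $(B_1\cup B_2\cup B_3)\setminus B_{i^*}$ and $A$ can be ordered $a_1,\dots,a_t$ with $N(a_t)\cap B_{i^*}\subseteq\cdots\subseteq N(a_1)\cap B_{i^*}=B_{i^*}$; $A$ is anticomplete to $C_1\cup C_2\cup C_3$; each $B_i$ is complete to $C_i$ and anticomplete to $C_j$ for $j\ne i$; and there is $j^*$ such that $F$ is complete to $V(Q)\setminus(B_{j^*}\cup C_{j^*}\cup F)$ and anticomplete to $B_{j^*}\cup C_{j^*}$. $t$-villa ($t\ge3$): a graph $Q$ whose vertex set partitions into nonempty cliques $A,B_1,\dots,B_t,C_1,\dots,C_t$ such that $A$ is complete to $B_1\cup\dots\cup B_t$ and anticomplete to $C_1\cup\dots\cup C_t$; the $B_i$ are pairwise anticomplete; the $C_i$ are pairwise complete; $B_i$ is anticomplete to $C_j$ for $i\ne j$; each $B_i$ can be ordered $b^i_1,\dots,b^i_{r_i}$ with $\emptyset\ne N(b^i_{r_i})\cap C_i\subseteq\dots\subseteq N(b^i_1)\cap C_i=C_i$. Then $(A;B_1,\dots,B_t;C_1,\dots,C_t)$ is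 a $t$-villa partition. A villa is a $t$-villa for some $t\ge3$. $t$-mansion ($t\ge3$): a graph $Q$ whose vertex set partitions into cliques $A,B_1,\dots,B_t,C_1,\dots,C_t,F,X,Y$, with $A,B_i,C_i,F$ nonempty ($X,Y$ possibly empty), such that $Q[A\cup B_1\cup\dots\cup C_t]$ is a $t$-villa with $t$-villa partition $(A;B_1,\dots,B_t;C_1,\dots,C_t)$; there is $j^*$ such that $F$ is complete to $A$, to $\bigcup_{i\ne j^*}B_i$ and to $\bigcup_{i\ne j^*}C_i$ and anticomplete to $B_{j^*}\cup C_{j^*}$, $B_{j^*}$ is complete to $C_{j^*}$, and $X$ is complete to $A\cup B_{j^*}$ and anticomplete to $\bigcup_{i\ne j^*}B_i$ and to $C_1\cup\dots\cup C_t$; $F$ is complete to $X\cup Y$; $X$ is anticomplete to $Y$; $Y$ is complete to $C_1\cup\dots\cup C_t$ and anticomplete to $A\cup B_1\cup\dots\cup B_t$. A mansion is a $t$-mansion for some $t\ge3$. *)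

(* Defs.v *)
(* A graph is a finite type T with a symmetric irreflexive
   boolean adjacency relation E. *)
From mathcomp Require Import all_boot.
Set Implicit Arguments.
Unset Strict Implicit.
Unset Printing Implicit Defensive.

Section Defs.
Variables (T : finType) (E : rel T).

Definition nbr_in (v : T) (X : {set T}) : {set T} := [set x in X | E v x].

Definition clique (X : {set T}) : Prop :=
  forall x y, x \in X -> y \in X -> x != y -> E x y.
Definition stable (X : {set T}) : Prop :=
  forall x y, x \in X -> y \in X -> ~~ E x y.
Definition complete (X Y : {set T}) : Prop :=
  forall x y, x \in X -> y \in Y -> E x y.
Definition anticomplete (X Y : {set T}) : Prop :=
  forall x y, x \in X -> y \in Y -> ~~ E x y.

Definition simplicial (v : T) : Prop := clique [set u | E v u].
Definition universal (v : T) : Prop := forall u, u != v -> E v u.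

Definition parts_partition (s : seq {set T}) (Q : {set T}) : Prop :=
  \bigcup_(P <- s) P = Q /\ pairwise (fun P R : {set T} => [disjoint P & R]) s.

Definition anticonnected (X : {set T}) : Prop :=
  forall x y, x \in X -> y \in X ->
    connect (fun u v => [&& u \in X, v \in X, u != v & ~~ E u v]) x y.

Definition anticomponent (X : {set T}) : Prop :=
  X != set0 /\ anticonnected X /\
  (forall Y : {set T}, X \subset Y -> anticonnected Y -> Y = X).

Definition nested_ordering (A X : {set T}) : Prop :=
  exists s : seq T, uniq s /\ [set x in s] = A /\
    pairwise (fun a b => nbr_in b X \subset nbr_in a X) s /\
    (match s with a :: _ => nbr_in a X = X | [::] => False end).

Definition nested_ordering_ne (A X : {set T}) : Prop :=
  exists s : seq T, uniq s /\ [set x in s] = A /\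
    pairwise (fun a b => nbr_in b X \subset nbr_in a X) s /\
    (match s with
     | a :: s' => nbr_in a X = X /\ nbr_in (last a s') X != set0
     | [::] => False end).

(* Q (as induced subgraph G[Q]) is a 5-basket; indices 1,2,3 are 0,1,2 *)
Definition is_5basket (Q : {set T}) : Prop :=
  exists (A : {set T}) (B C : 'I_3 -> {set T}) (F : {set T})
         (istar jstar : 'I_3),
    parts_partition (A :: F :: [seq B i | i <- enum 'I_3]
                              ++ [seq C i | i <- enum 'I_3]) Q /\
    A != set0 /\ clique A /\
    (forall i, B i != set0 /\ clique (B i) /\ C i != set0 /\ clique (C i)) /\
    clique F /\
    (forall i j, i != j -> anticomplete (B i) (B j)) /\
    (forall i j, i != j -> complete (C i) (C j)) /\
    complete A ((\bigcup_i B i) :\: B istar) /\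
    nested_ordering A (B istar) /\
    anticomplete A (\bigcup_i C i) /\
    (forall i, complete (B i) (C i)) /\
    (forall i j, i != j -> anticomplete (B i) (C j)) /\
    complete F (Q :\: (B jstar :|: C jstar :|: F)) /\
    anticomplete F (B jstar :|: C jstar).

Definition villa_partition (t : nat) (Q A : {set T}) (B C : 'I_t -> {set T})
  : Prop :=
  parts_partition (A :: [seq B i | i <- enum 'I_t]
                        ++ [seq C i | i <- enum 'I_t]) Q /\
  A != set0 /\ clique A /\
  (forall i, B i != set0 /\ clique (B i) /\ C i != set0 /\ clique (C i)) /\
  complete A (\bigcup_i B i) /\ anticomplete A (\bigcup_i C i) /\
  (forall i j, i != j -> anticomplete (B i) (B j)) /\
  (forall i j, i != j -> complete (C i) (C j)) /\
  (forall i j, i != j -> anticomplete (B i) (C j)) /\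
  (forall i, nested_ordering_ne (B i) (C i)).

Definition is_villa_t (t : nat) (Q : {set T}) : Prop :=
  3 <= t /\ exists A (B C : 'I_t -> {set T}), villa_partition Q A B C.

Definition is_villa (Q : {set T}) : Prop := exists t, is_villa_t t Q.

Definition is_mansion_t (t : nat) (Q : {set T}) : Prop :=
  3 <= t /\
  exists (A : {set T}) (B C : 'I_t -> {set T}) (F X Y : {set T}) (jstar : 'I_t),
    parts_partition (A :: F :: X :: Y :: [seq B i | i <- enum 'I_t]
                              ++ [seq C i | i <- enum 'I_t]) Q /\
    F != set0 /\ clique F /\ clique X /\ clique Y /\
    villa_partition (A :|: (\bigcup_i B i) :|: (\bigcup_i C i)) A B C /\
    complete F A /\ complete F (\bigcup_(i | i != jstar) B i) /\
    complete F (\bigcup_(i | i != jstar) C i) /\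
    anticomplete F (B jstar :|: C jstar) /\
    complete (B jstar) (C jstar) /\
    complete X (A :|: B jstar) /\
    anticomplete X (\bigcup_(i | i != jstar) B i) /\
    anticomplete X (\bigcup_i C i) /\
    complete F (X :|: Y) /\
    anticomplete X Y /\
    complete Y (\bigcup_i C i) /\
    anticomplete Y (A :|: \bigcup_i B i).

Definition is_mansion (Q : {set T}) : Prop := exists t, is_mansion_t t Q.

Definition has_induced (S : finType) (eS : rel S) : Prop :=
  exists f : S -> T, injective f /\ forall x y, E (f x) (f y) = eS x y.

End Defs.

Definition graph_of_edges (n : nat) (es : seq (nat * nat)) : rel 'I_n :=
  fun x y => ((x : nat, y : nat) \in es) || ((y : nat, x : nat) \in es).
Arguments graph_of_edges : clear implicits.

Definition twoP3 := graph_of_edges 6 [:: (0,1); (1,2); (3,4); (4,5)].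
Definition C4 := graph_of_edges 4 [:: (0,1); (1,2); (2,3); (3,0)].
Definition C6 := graph_of_edges 6 [:: (0,1); (1,2); (2,3); (3,4); (4,5); (5,0)].
Definition C7 :=
  graph_of_edges 7 [:: (0,1); (1,2); (2,3); (3,4); (4,5); (5,6); (6,0)].
(* T0: p=0, q=1, u0..u3 = 2..5, w1..w3 = 6..8 *)
Definition T0 := graph_of_edges 9
  [:: (0,1); (0,2); (0,4); (0,5); (1,3); (1,4); (1,5);
      (2,6); (3,6); (4,7); (5,8); (6,7); (6,8); (7,8)].
(* 3-pentagon: a=0, b1..b3 = 1..3, c1..c3 = 4..6 *)
Definition pentagon3 := graph_of_edges 7
  [:: (0,1); (0,2); (0,3); (1,4); (2,5); (3,6); (4,5); (4,6); (5,6)].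

(* Main.v *)
(* Relative to an induced 3-pentagon, forbidding the five graphs leaves only 14
   kinds of vertices up to symmetry, and the kinds of two vertices mostly
   determine whether they are adjacent.  This is a finite computation, done here
   by a verified search; so are the claims about three or four vertices needed
   below.  Kinds which do not occur in a basket, a villa or a mansion are
   excluded with [minimal_contra], which produces a simplicial vertex.  If the
   closed neighbourhood of some vertex meets some pentagon in {a, b_j, b_k} or in
   {b_i, c_i}, the remaining kinds form a 5-basket; otherwise the components of
   the neighbours of a outside A are the B_i of a villa, to which a vertex seeing
   all of a pentagon but b_i and c_i adds the cliques F, X and Y of a mansion.
   Conversely, label the vertices of a 5-basket, villa or mansion by their parts:
   no labelling of a forbidden graph respects the adjacencies between parts,
   except labellings of C4 excluded by the nested neighbourhoods. *)

(* A villa or mansion may have arbitrarily many pairs B_i, C_i, while a pentagon meets only three of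
   them. On the pentagon, vertices of the other B_i leave only the trace {a} and those of the other
   C_i only {c_1, c_2, c_3}, so a search over kinds cannot separate them. They are separated
   afterwards, as classes of an equivalence relation; in the converse one label covers all of them,
   and a condition on triples of vertices replaces the lost index. A second obstacle is that the
   kinds of two vertices do not always decide their adjacency. A third vertex then does, for
   instance a neighbour in A or in some C_i, and its existence is again a consequence of having no
   simplicial vertices. This is why the minimality argument returns several times, each time with
   another set of vertices to eliminate and another clique. The case distinction is made on the
   whole graph, by asking whether it contains a pentagon with one particular extra vertex, and not
   around a fixed pentagon. An absent pattern can then be treated as one more forbidden graph. *)
Require Import Defs.
From mathcomp Require Import all_boot.

Set Implicit Arguments.
Unset Strict Implicit.
Unset Printing Implicit Defensive.

(** * Searching for induced subgraphs *)

Definition edges_rel (es : seq (nat * nat)) (x y : nat) : bool :=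
  ((x, y) \in es) || ((y, x) \in es).

Definition pattern := (nat * seq (nat * nat))%type.

Definition pat2P3 : pattern := (6, [:: (0,1); (1,2); (3,4); (4,5)]).
Definition patC4 : pattern := (4, [:: (0,1); (1,2); (2,3); (3,0)]).
Definition patC6 : pattern := (6, [:: (0,1); (1,2); (2,3); (3,4); (4,5); (5,0)]).
Definition patC7 : pattern :=
  (7, [:: (0,1); (1,2); (2,3); (3,4); (4,5); (5,6); (6,0)]).
Definition patT0 : pattern :=
  (9, [:: (0,1); (0,2); (0,4); (0,5); (1,3); (1,4); (1,5);
          (2,6); (3,6); (4,7); (5,8); (6,7); (6,8); (7,8)]).
Definition patP3 : pattern :=
  (7, [:: (0,1); (0,2); (0,3); (1,4); (2,5); (3,6); (4,5); (4,6); (5,6)]).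

Definition rows_of (p : pattern) : seq bitseq :=
  [seq [seq edges_rel p.2 i j | j <- iota 0 i] | i <- iota 0 p.1].

Definition twin_free (p : pattern) : bool :=
  all (fun i => all (fun j => (i == j) || ~~ edges_rel p.2 i j ||
    has (fun k => [&& k != i, k != j & edges_rel p.2 i k != edges_rel p.2 j k])
      (iota 0 p.1)) (iota 0 p.1)) (iota 0 p.1).

(* The searches below branch with [if] rather than [&&], [||] so that
   call-by-value evaluation prunes. *)
Fixpoint anyb (S : Type) (p : S -> bool) (s : seq S) : bool :=
  if s is x :: s' then if p x then true else anyb p s' else false.

Lemma anybE (S : Type) (p : S -> bool) s : anyb p s = has p s.
Proof. by elim: s => //= x s ->; case: (p x). Qed.

(* The rows of [M] are the strict lower triangle of an adjacency matrix. *)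
Definition adjM (M : seq bitseq) (i j : nat) : bool :=
  if i == j then true
  else if j < i then nth false (nth [::] M i) j else nth false (nth [::] M j) i.

Fixpoint fits (M : seq bitseq) (v : nat) (f : seq nat) (r : bitseq) : bool :=
  match f, r with
  | u :: f', e :: r' => if adjM M v u == e then fits M v f' r' else false
  | [::], [::] => true
  | _, _ => false
  end.

(** [h] lists the rows of the pattern still to be placed, [f] the images chosen so far. Repeated
    images are permitted; [adjM] is reflexive to match. *)
Fixpoint emb (M : seq bitseq) (N : seq nat) (h : seq bitseq) (f : seq nat) :=
  if h is r :: h' then
    anyb (fun v => if fits M v f r then emb M N h' (rcons f v) else false) N
  else true.

Definition free (fam : seq pattern) (M : seq bitseq) : bool :=
  ~~ anyb (fun p => emb M (iota 0 (size M)) (rows_of p) [::]) fam.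

Lemma fitsP M v f r :
  fits M v f r ->
  size r = size f /\
  forall k, k < size f -> adjM M v (nth 0 f k) = nth false r k.
Proof.
elim: f r => [|u f IH] [|e r] //=.
case: eqP => // <- /IH[-> H]; split=> // -[|k] //=; exact: H.
Qed.

(** Soundness is the direction that matters: the searches certify that a configuration contains a
    forbidden graph, so every success must come from a real copy. *)
Lemma embP M N h f :
  emb M N h f ->
  exists g, [/\ size g = size h, {subset g <= N} &
    forall k, k < size h -> fits M (nth 0 g k) (f ++ take k g) (nth [::] h k)].
Proof.
elim: h f => [|r h IH] f /=; first by move=> _; exists [::].
rewrite anybE => /hasP[v vN]; case fv: (fits M v f r) => // /IH[g [sg gN Hg]].
exists (v :: g); split=> /=; first by rewrite sg.
  by move=> u; rewrite inE => /orP[/eqP->|/gN].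
case=> [_|k kh] /=; first by rewrite cats0.
by rewrite -cat_rcons; exact: Hg.
Qed.

Section Reflexive.
Variables (T : finType) (E : rel T).
Hypotheses (Esym : symmetric E) (Eirr : irreflexive E).

(* Working with the reflexive closure of adjacency removes all equality tests:
   no pattern below has adjacent twins, so a copy of it found in a list of
   vertices with repetitions is still induced. *)
Definition radj (x y : T) : bool := (x == y) || E x y.
Local Notation R := radj.

Lemma Rxx x : R x x. Proof. by rewrite /radj eqxx. Qed.
Lemma Rsym x y : R x y = R y x.
Proof. by rewrite /radj eq_sym Esym. Qed.
Lemma R_E x y : x != y -> R x y = E x y.
Proof. by rewrite /radj => /negbTE->. Qed.
Lemma ER x y : E x y -> R x y.
Proof. by rewrite /radj => ->; rewrite orbT. Qed.
Lemma nR_E x y : ~~ R x y -> ~~ E x y.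
Proof. by apply: contra => /ER. Qed.
Lemma nR_neq x y : ~~ R x y -> x != y.
Proof. by apply: contra => /eqP->; rewrite Rxx. Qed.

Definition omits (p : pattern) : Prop :=
  ~ has_induced E (graph_of_edges p.1 p.2).

(** Two indices with the same image would be adjacent in the pattern, as [R] is reflexive, and would
    have the same neighbours; [twin_free] forbids this, which gives injectivity. *)
Lemma realized_induced (p : pattern) (w : nat -> T) :
  twin_free p -> all (fun e => e.1 != e.2) p.2 ->
  (forall i j, j < i < p.1 -> R (w i) (w j) = edges_rel p.2 i j) ->
  has_induced E (graph_of_edges p.1 p.2).
Proof.
case: p => n es /= fo3 lf H.
have er_sym i j : edges_rel es i j = edges_rel es j i by rewrite /edges_rel orbC.
have H2 i j : i < n -> j < n -> i != j -> R (w i) (w j) = edges_rel es i j.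
  move=> ni nj; rewrite neq_ltn => /orP[l|l]; last by apply: H; rewrite l.
  by rewrite Rsym er_sym; apply: H; rewrite l.
have inj i j : i < n -> j < n -> w i = w j -> i = j.
  move=> ni nj wij; apply/eqP; apply: contraT => nij.
  have /allP/(_ i) := fo3; rewrite mem_iota => /(_ ni)/allP/(_ j).
  rewrite mem_iota => /(_ nj) /=; rewrite (negbTE nij) /= -H2 // wij Rxx /=.
  case/hasP=> k; rewrite mem_iota /= => nk /and3P[ki kj].
  by rewrite -!H2 // 1?eq_sym // wij eqxx.
exists (fun i : 'I_n => w i); split=> [i j wij|x y].
  by apply: val_inj; apply: inj; rewrite ?ltn_ord.
rewrite /graph_of_edges; case: (altP (x =P y)) => [->|nxy].
  rewrite Eirr; apply/esym/negbTE; rewrite orbb; apply/negP => /(allP lf) /=.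
  by rewrite eqxx.
rewrite -[_ || _]/(edges_rel es x y) -H2 // R_E //.
by apply: contra nxy => /eqP e; apply/eqP/val_inj/inj; rewrite ?ltn_ord.
Qed.

(** The prefix [pre] lets the matrix of a pentagon followed by further vertices split into [Pm] and
    the rows of those vertices. *)
Fixpoint mat (pre vs : seq T) : seq bitseq :=
  if vs is v :: vs' then [seq R v u | u <- pre] :: mat (rcons pre v) vs' else [::].

Lemma size_mat pre vs : size (mat pre vs) = size vs.
Proof. by elim: vs pre => //= v vs IH pre; rewrite IH. Qed.

Lemma mat_cat pre vs ws : mat pre (vs ++ ws) = mat pre vs ++ mat (pre ++ vs) ws.
Proof.
elim: vs pre => [|v vs IH] pre /=; first by rewrite cats0.
by rewrite IH cat_rcons.
Qed.

Lemma nth_mat x0 pre vs i : i < size vs ->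
  nth [::] (mat pre vs) i = [seq R (nth x0 vs i) u | u <- pre ++ take i vs].
Proof.
elim: vs pre i => [|v vs IH] pre [|i] //= lt_i; first by rewrite cats0.
by rewrite IH // cat_rcons.
Qed.

Lemma adj_mat x0 vs i j : i < size vs -> j < size vs ->
  adjM (mat [::] vs) i j = R (nth x0 vs i) (nth x0 vs j).
Proof.
rewrite /adjM => ni nj; case: eqP => [->|/eqP]; first by rewrite Rxx.
have lower k l : l < k -> k < size vs ->
    nth false (nth [::] (mat [::] vs) k) l = R (nth x0 vs k) (nth x0 vs l).
  move=> lk nk; rewrite (nth_mat x0) //= (nth_map x0) ?nth_take //.
  by rewrite size_take nk.
rewrite neq_ltn; case: (ltngtP i j) => // l _; last exact: lower.
by rewrite Rsym; exact: lower.
Qed.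

Definition proper_pattern (p : pattern) : bool :=
  twin_free p && all (fun e => e.1 != e.2) p.2.

Definition omits_all (fam : seq pattern) : Prop :=
  forall p, p \in fam -> proper_pattern p /\ omits p.

Lemma mat_free fam (x0 : T) vs : omits_all fam -> free fam (mat [::] vs).
Proof.
move=> om; rewrite /free anybE; apply/hasP => -[p /om[/andP[fo3 lf]]] no.
case/embP=> g [sg gN Hg]; apply: no.
have sg' : size g = p.1 by rewrite sg /rows_of size_map size_iota.
have gn k : k < p.1 -> nth 0 g k < size vs.
  move=> kp; have := gN (nth 0 g k); rewrite mem_nth ?sg' // => /(_ isT).
  by rewrite mem_iota /= size_mat.
apply: (@realized_induced p (fun i => nth x0 vs (nth 0 g i))) => // i j /andP[ji ip].
have lt_jp := ltn_trans ji ip.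
have := Hg i; rewrite -sg sg' => /(_ ip)/fitsP[_].
rewrite /= size_take sg' ip => /(_ j ji); rewrite nth_take // (adj_mat x0) ?gn // => ->.
by rewrite /rows_of (nth_map 0) ?size_iota // (nth_map 0) ?size_iota // !nth_iota.
Qed.

End Reflexive.

(** * Vertices around a 3-pentagon *)

Definition fam0 := [:: patC4; pat2P3; patC6; patC7; patT0].
(* The 3-pentagon plus a vertex of kind [KAk I0], [KD I0], [KF I0] (see [code]).
   A copy of one of the first two makes the graph a 5-basket; otherwise a copy
   of the third separates mansions from villas. *)
Definition patA : pattern := (8, patP3.2 ++ [:: (7,0); (7,2); (7,3)]).
Definition patD : pattern := (8, patP3.2 ++ [:: (7,1); (7,4)]).
Definition patF : pattern := (8, patP3.2 ++ [:: (7,0); (7,2); (7,3); (7,5); (7,6)]).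
Definition famM := [:: patA, patD & fam0].
Definition famV := patF :: famM.

Inductive idx := I0 | I1 | I2.
Definition idxs := [:: I0; I1; I2].
Definition ieq (i j : idx) : bool :=
  match i, j with I0, I0 | I1, I1 | I2, I2 => true | _, _ => false end.

(* The possible traces of a closed neighbourhood on a 3-pentagon listed as
   a; b_1, b_2, b_3; c_1, c_2, c_3. *)
Inductive kind :=
  | KZ | KL | KBo of idx | KX of idx | KAk of idx | KA
  | KLc of idx | KD of idx | KB of idx | KLcc of idx | KF of idx | KY
  | KC of idx | KU.

Definition only (i : idx) : bitseq := [seq ieq i j | j <- idxs].
Definition but (i : idx) : bitseq := [seq ~~ ieq i j | j <- idxs].
Definition none3 := [:: false; false; false].
Definition all3 := [:: true; true; true].

(** Since the neighbourhoods are closed, [KA], [KB i] and [KC i] are the kinds of a, b_i and c_i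
    themselves. Vertices of kind [KU] will turn out to be the universal ones. *)
Definition code (k : kind) : bitseq :=
  match k with
  | KZ => false :: none3 ++ none3
  | KL => true :: none3 ++ none3
  | KBo i => false :: only i ++ none3
  | KX i => true :: only i ++ none3
  | KAk i => true :: but i ++ none3
  | KA => true :: all3 ++ none3
  | KLc i => false :: none3 ++ only i
  | KD i => false :: only i ++ only i
  | KB i => true :: only i ++ only i
  | KLcc i => false :: none3 ++ but i
  | KF i => true :: but i ++ but i
  | KY => false :: none3 ++ all3
  | KC i => false :: only i ++ all3
  | KU => true :: all3 ++ all3
  end.

Definition kinds : seq kind :=
  [:: KZ; KL; KA; KY; KU] ++
  flatten [seq [:: KBo i; KX i; KAk i; KLc i; KD i; KB i; KLcc i; KF i; KC i] | i <- idxs].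

Definition Pm : seq bitseq := rows_of patP3.

(** Each entry of [l] pairs the kind of a vertex with its adjacencies to the preceding entries. *)
Definition okx (fam : seq pattern) (l : seq (kind * bitseq)) : bool :=
  free fam (Pm ++ [seq code kb.1 ++ kb.2 | kb <- l]).

Fixpoint bitseqs n : seq bitseq :=
  if n is m.+1 then
    [seq true :: b | b <- bitseqs m] ++ [seq false :: b | b <- bitseqs m]
  else [:: [::]].

Fixpoint allb (S : Type) (p : S -> bool) (s : seq S) : bool :=
  if s is x :: s' then if p x then allb p s' else false else true.

Lemma allbE (S : Type) (p : S -> bool) s : allb p s = all p s.
Proof. by elim: s => //= x s ->; case: (p x). Qed.

Lemma mem_bitseqs b : b \in bitseqs (size b).
Proof.
elim: b => //= e b IH; rewrite mem_cat; apply/orP.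
by case: e; [left|right]; apply: map_f.
Qed.

(** There are 128 traces. The 32 in [kinds] are the 14 kinds with all their indices; any other trace
    already completes a forbidden graph. *)
Lemma types_complete :
  allb (fun c => if has (fun k => code k == c) kinds then true
                 else ~~ free fam0 (rcons Pm c)) (bitseqs 7).
Proof. by vm_compute. Qed.

Definition kidx (k : kind) : nat := find (fun k' => code k' == code k) kinds.

(* Precomputed, so that only the pairs claimed impossible are rechecked. *)
Definition tab1 (e : bool) : seq bitseq :=
  [seq [seq okx fam0 [:: (k1, [::]); (k2, [:: e])] | k2 <- kinds] | k1 <- kinds].
Definition tabT : seq bitseq := Eval vm_compute in tab1 true.
Definition tabF : seq bitseq := Eval vm_compute in tab1 false.

Definition allowed (k1 k2 : kind) (e : bool) : bool :=
  nth false (nth [::] (if e then tabT else tabF) (kidx k1)) (kidx k2).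

Lemma allowed_complete :
  allb (fun k1 => allb (fun k2 => allb (fun e =>
    if allowed k1 k2 e then true else ~~ okx fam0 [:: (k1, [::]); (k2, [:: e])])
  [:: true; false]) kinds) kinds.
Proof. by vm_compute. Qed.

Definition forced (P Q : pred kind) (e : bool) : bool :=
  allb (fun k1 => if P k1 then
    allb (fun k2 => if Q k2 then ~~ allowed k1 k2 (~~ e) else true) kinds
    else true) kinds.

(** [G] is what a triple must satisfy unless it contains a member of [fam]; with [G] constantly
    false, the triple cannot occur. Only triples whose pairs are all possible reach the search. *)
Definition triple_forced (fam : seq pattern) (V P Q : pred kind)
    (G : kind -> kind -> kind -> bool) (e1 e2 e3 : bool) : bool :=
  allb (fun kv => if V kv then
    allb (fun kx => if P kx then if allowed kv kx e1 then
      allb (fun ky => if Q ky then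
        if G kv kx ky then true else
        if allowed kv ky e2 then if allowed kx ky e3 then
          ~~ okx fam [:: (kv, [::]); (kx, [:: e1]); (ky, [:: e2; e3])]
        else true else true else true) kinds
      else true else true) kinds else true) kinds.

Lemma allb_kinds (Q : kind -> bool) : allb Q kinds -> forall k, Q k.
Proof.
rewrite allbE /= => + k.
by do ![case/andP => ?]; case: k => [||[]|[]|[]||[]|[]|[]|[]|[]||[]|].
Qed.

Lemma okxE fam l : okx fam l = free fam (Pm ++ [seq code kb.1 ++ kb.2 | kb <- l]).
Proof. by []. Qed.

(* Keeps [done] and [simpl] from running the searches by lazy reduction. *)
#[global] Opaque free okx.

#[global] Opaque allowed kinds.

Lemma triple_forcedE fam (V P Q : pred kind) G e1 e2 e3 :
  triple_forced fam V P Q G e1 e2 e3 ->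
  forall kv kx ky, V kv -> P kx -> Q ky ->
    allowed kv kx e1 -> allowed kv ky e2 -> allowed kx ky e3 ->
    okx fam [:: (kv, [::]); (kx, [:: e1]); (ky, [:: e2; e3])] -> G kv kx ky.
Proof.
move=> H kv kx ky Vv Px Qy.
have /allb_kinds/(_ kv) := H; rewrite Vv => /allb_kinds/(_ kx); rewrite Px.
destruct (allowed kv kx e1) => [/allb_kinds/(_ ky)|//]; rewrite Qy.
destruct (G kv kx ky) => //.
destruct (allowed kv ky e2) => //; destruct (allowed kx ky e3) => //.
by move=> /negbTE->.
Qed.

Fact kd_key : unit. Proof. exact: tt. Qed.

Section Pentagon.
Variables (T : finType) (E : rel T).
Hypotheses (Esym : symmetric E) (Eirr : irreflexive E).
Local Notation R := (radj E).
Hypothesis om0 : omits_all E fam0.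
Variables (x0 : T) (p : seq T).
Hypothesis hp : mat E [::] p = Pm.

Definition ty (x : T) : bitseq := [seq R x v | v <- p].

(* Locked, so that unification never evaluates a [kd x]. *)
Definition kd : T -> kind :=
  locked_with kd_key (fun x => nth KZ kinds (find (fun k => code k == ty x) kinds)).

Lemma size_pent : size p = 7.
Proof. by rewrite -(size_mat E [::] p) hp. Qed.

Lemma code_kd x : code (kd x) = ty x.
Proof.
suff: has (fun k => code k == ty x) kinds by move/(nth_find KZ)/eqP; rewrite /kd unlock.
have := types_complete; rewrite allbE => /allP/(_ (ty x)).
rewrite (_ : 7 = size (ty x)) ?mem_bitseqs => [/(_ isT)|]; last first.
  by rewrite size_map size_pent.
case: has => //; rewrite (_ : rcons Pm (ty x) = mat E [::] (p ++ [:: x])).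
  by rewrite (mat_free Esym Eirr x0).
by rewrite mat_cat /= hp cats1.
Qed.

Fixpoint kmat (pre xs : seq T) : seq (kind * bitseq) :=
  if xs is x :: xs' then (kd x, [seq R x u | u <- pre]) :: kmat (rcons pre x) xs'
  else [::].

(** The vertices of [xs] may coincide or lie on the pentagon, so no distinctness conditions arise
    when this is applied. *)
Lemma okxP fam xs : omits_all E fam -> okx fam (kmat [::] xs).
Proof.
move=> om; have := mat_free Esym Eirr x0 (p ++ xs) om.
rewrite mat_cat hp okxE.
suff -> : forall pre, [seq code kb.1 ++ kb.2 | kb <- kmat pre xs] = mat E (p ++ pre) xs.
  by rewrite cats0.
elim: xs => //= x xs IH pre; rewrite IH code_kd /ty -map_cat.
by rewrite rcons_cat.
Qed.

Lemma allowedP x y : allowed (kd x) (kd y) (R x y).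
Proof.
have /allb_kinds/(_ (kd x))/allb_kinds/(_ (kd y)) := allowed_complete.
rewrite allbE => /allP/(_ (R x y)); have := okxP [:: x; y] om0.
rewrite /= (Rsym Esym y x) => -> /=.
by case: allowed => //; case: (R x y) => /(_ isT).
Qed.

Lemma forcedP P Q e : forced P Q e ->
  forall x y, P (kd x) -> Q (kd y) -> R x y = e.
Proof.
move=> H x y Px Qy; have := allowedP x y.
have /allb_kinds/(_ (kd x)) := H; rewrite Px => /allb_kinds/(_ (kd y)).
by rewrite Qy; case: (R x y); case: e {H} => // /negbTE->.
Qed.

Lemma triple_forcedP fam V P Q G e1 e2 e3 : omits_all E fam ->
  triple_forced fam V P Q G e1 e2 e3 ->
  forall v x y, V (kd v) -> P (kd x) -> Q (kd y) ->
    R v x = e1 -> R v y = e2 -> R x y = e3 -> G (kd v) (kd x) (kd y).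
Proof.
move=> om H v x y Vv Px Qy Rvx Rvy Rxy.
have a1 : allowed (kd v) (kd x) e1 by rewrite -Rvx; exact: allowedP.
have a2 : allowed (kd v) (kd y) e2 by rewrite -Rvy; exact: allowedP.
have a3 : allowed (kd x) (kd y) e3 by rewrite -Rxy; exact: allowedP.
apply: (triple_forcedE H Vv Px Qy a1 a2 a3).
have := okxP [:: v; x; y] om; cbn [kmat map rcons].
by rewrite (Rsym Esym x v) (Rsym Esym y v) (Rsym Esym y x) Rvx Rvy Rxy.
Qed.

Lemma kd_pent i : i < 7 ->
  code (kd (nth x0 p i)) = [seq adjM Pm i j | j <- iota 0 7].
Proof.
move=> i7; rewrite code_kd /ty; apply: (@eq_from_nth _ false).
  by rewrite !size_map size_pent.
rewrite size_map size_pent => j j7.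
by rewrite (nth_map x0) ?size_pent // (nth_map 0) ?size_iota // nth_iota // -hp
   (adj_mat _ x0) ?size_pent.
Qed.

Lemma R_pent i x : i < 7 -> R x (nth x0 p i) = nth false (code (kd x)) i.
Proof. by move=> i7; rewrite code_kd (nth_map x0) ?size_pent. Qed.

End Pentagon.

#[global] Opaque forced triple_forced.

(** * Eliminating simplicial vertices *)

Definition isZ k := if k is KZ then true else false.
Definition isL k := if k is KL then true else false.
Definition isBo k := if k is KBo _ then true else false.
Definition isX k := if k is KX _ then true else false.
Definition isAk k := if k is KAk _ then true else false.
Definition isA k := if k is KA then true else false.
Definition isLc k := if k is KLc _ then true else false.
Definition isD k := if k is KD _ then true else false.
Definition isB k := if k is KB _ then true else false.
Definition isLcc k := if k is KLcc _ then true else false.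
Definition isF k := if k is KF _ then true else false.
Definition isY k := if k is KY then true else false.
Definition isC k := if k is KC _ then true else false.
Definition isU k := if k is KU then true else false.

(* Kinds that do not occur once there are no simplicial vertices. *)
Definition spurious k := [|| isBo k, isLc k | isLcc k].
(** Any two vertices of these kinds are adjacent; they serve as the clique [W] of
    [minimal_contra]. *)
Definition isW k := [|| isA k, isF k | isU k].

Ltac rewrite_adj :=
  lazymatch goal with Esym : symmetric ?E |- _ =>
    repeat match goal with
    | H : is_true (radj E ?u ?v) |- context [radj E ?u ?v] => rewrite H
    | H : is_true (radj E ?u ?v) |- context [radj E ?v ?u] => rewrite (Rsym Esym v u) H
    | H : is_true (~~ radj E ?u ?v) |- context [radj E ?u ?v] => rewrite (negbTE H)
    | H : is_true (~~ radj E ?u ?v) |- context [radj E ?v ?u] =>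
        rewrite (Rsym Esym v u) (negbTE H)
    | H : kd E ?p ?u = _ |- context [kd E ?p ?u] => rewrite H
    end end.

(** Free indices and adjacencies that no hypothesis settles are split, so that one refutation covers
    every possibility for them. *)
Ltac compute_cases :=
  repeat match goal with
    | H : is_true (~~ ieq ?i ?i) |- _ => discriminate H
    | i : idx |- _ => destruct i
    end;
  repeat match goal with |- context [radj ?E ?u ?v] => destruct (radj E u v) end;
  vm_compute; try discriminate.

(* [ok] is an instance of [okxP]. *)
Ltac refute ok :=
  lazymatch goal with
  | |- is_true (~~ radj _ _ _) => apply/negP => ?
  | |- is_true (radj _ _ _) => apply: contraT => ?
  | |- _ => exfalso
  end;
  generalize ok; cbn [kmat map rcons]; rewrite_adj; compute_cases.

Section Clear.
Variables (T : finType) (E : rel T).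
Hypotheses (Esym : symmetric E) (Eirr : irreflexive E).
Local Notation R := (radj E).
Hypothesis om0 : omits_all E fam0.
Hypothesis ns : forall v, ~ simplicial E v.

Lemma R_C4 x y z w : R x y -> R y z -> R z w -> R w x -> R x z || R y w.
Proof.
move=> xy yz zw wx; have := mat_free Esym Eirr x [:: x; y; z; w] om0.
cbn [mat map rcons]; rewrite_adj; rewrite (Rsym Esym x z) (Rsym Esym y w).
case: (R z x) => //; case: (R w y) => //; vm_compute; discriminate.
Qed.

(* A vertex of [S] with as few neighbours in [W] as possible is simplicial: a
   neighbour in [S] missing one of them would have a private neighbour in [W],
   giving a 4-cycle. *)
Lemma minimal_contra (S W : pred T) :
  (forall w w', W w -> W w' -> R w w') ->
  (forall v x y, S v -> R v x -> R v y -> ~~ R x y ->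
     S x && W y || S y && W x) ->
  forall v, ~~ S v.
Proof.
move=> Wc H v0; apply/negP => Sv0.
pose N v := [set w | W w && R v w].
have [v Sv vmin] := arg_minnP (fun v => #|N v|) Sv0.
have key x y : R v x -> R v y -> ~~ R x y -> S x -> W y -> False.
  move=> vx vy nxy Sx Wy; have := vmin x Sx; rewrite leqNgt => /negP; apply.
  (* The vertex [y] counts for [v] but not for [x]. Conversely, if [x] sees [w] in [W], then v, x,
     w, y is a 4-cycle whose only possible chord is v w. *)
  apply: proper_card; apply/properP; split; last first.
    by exists y; rewrite inE Wy //= .
  apply/subsetP => w; rewrite !inE => /andP[Ww xw]; rewrite Ww /=.
  have := @R_C4 v x w y vx xw (Wc _ _ Ww Wy); rewrite (Rsym Esym y v) => /(_ vy).
  by rewrite (negbTE nxy) orbF.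
apply: (ns (v := v)) => x y; rewrite !inE => vx vy nxy; apply: contraT => nE.
have nR : ~~ R x y by rewrite R_E.
case/orP: (H v x y Sv (ER vx) (ER vy) nR) => /andP[].
  by move=> Sx Wy; case: (key x y (ER vx) (ER vy) nR Sx Wy).
by rewrite Rsym // in nR; move=> Sy Wx; case: (key y x (ER vy) (ER vx) nR Sy Wx).
Qed.

Variables (x0 : T) (p : seq T).
Hypothesis hp : mat E [::] p = Pm.
Local Notation kd := (kd E p).
Let ok0 xs := okxP Esym Eirr om0 x0 hp xs om0.
Let fo P Q e := @forcedP T E Esym Eirr om0 x0 p hp P Q e.

Let fo3 V P Q G e1 e2 e3 :=
  @triple_forcedP T E Esym Eirr om0 x0 p hp fam0 V P Q G e1 e2 e3 om0.

(** By search, two nonadjacent neighbours of a spurious vertex are always a spurious one and one in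
    the clique [isW], which is what [minimal_contra] asks for. *)
Lemma no_spurious x : ~~ spurious (kd x).
Proof.
apply: (minimal_contra (S := fun x => spurious (kd x)) (W := fun x => isW (kd x))).
  move=> w w'.
  have h : forced isW isW true by vm_compute.
  exact: (fo h).
move=> v a b Sv va vb /negbTE nab.
pose G (_ kx ky : kind) := spurious kx && isW ky || spurious ky && isW kx.
have h : triple_forced fam0 spurious predT predT G true true false by vm_compute.
exact (fo3 h Sv isT isT va vb nab).
Qed.
(** In a villa, a vertex of kind [KL] lies in a B_i avoiding the pentagon, and its neighbours in C_i
    have kind [KY]. One with no neighbour of kind [KY] has to be eliminated. *)
Definition pendant x :=
  isZ (kd x) || isL (kd x) && [forall y, isY (kd y) ==> ~~ R x y].

(** The hypothesis guarantees that the neighbour found by the search is again pendant. Its proof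
    depends on the case: a 5-basket has no vertex of kind [KY], and otherwise the enlarged forbidden
    families give it. *)
Lemma no_pendant :
  (forall l y u, kd l = KL -> kd y = KY -> kd u = KU -> R l y -> R l u) ->
  forall x, ~~ pendant x.
Proof.
move=> UL; pose ZL k := isZ k || isL k; pose notY k := ~~ isY k.
apply: (minimal_contra (W := fun x => isW (kd x))).
  move=> w w'.
  have h : forced isW isW true by vm_compute.
  exact: (fo h).
move=> v x y Sv vx vy nxy.
have Kv : ZL (kd v) by case/orP: Sv => [|/andP[]]; rewrite /ZL => ->; rewrite ?orbT.
have vnY z : isY (kd z) -> ~~ R v z.
  move=> Yz; case/orP: Sv => [Zv|/andP[_ /forallP/(_ z)]]; last by rewrite Yz.
  have h : forced isZ isY false by vm_compute.
  by rewrite (fo h).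
have nY z : R v z -> notY (kd z) by apply: contraL => /vnY.
have : ZL (kd x) && isW (kd y) || ZL (kd y) && isW (kd x).
  pose G (_ kx ky : kind) := ZL kx && isW ky || ZL ky && isW kx.
  have h : triple_forced fam0 ZL notY notY G true true false by vm_compute.
  exact (fo3 h Kv (nY _ vx) (nY _ vy) vx vy (negbTE nxy)).
have key z w : R v z -> R v w -> ~~ R z w -> ZL (kd z) -> isW (kd w) -> pendant z.
  move=> vz vw nzw; rewrite /pendant; case kz: (kd z) => //= _ Ww.
  apply/forallP => q; apply/implyP; case kq: (kd q) => // _.
  have {}vnY : ~~ R v q by rewrite vnY ?kq.
  (* If [w] has kind [KU], then [UL] contradicts the nonadjacency of [z] and [w]; otherwise the
     vertices [v], [z], [w], [q], with [v] missing [q], contain a forbidden graph. *)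
  apply/negP => zq; case kw: (kd w) Ww => // _; last first.
  - by rewrite (UL _ _ _ kz kq kw zq) in nzw.
  - by case kv: (kd v) Kv => // _; refute (ok0 [:: v; z; w; q]).
  - by case kv: (kd v) Kv => // _; refute (ok0 [:: v; z; w; q]).
case/orP=> /andP[zk wk]; apply/orP; [left|right]; rewrite wk andbT.
  exact: key vx vy nxy zk wk.
by apply: key vy vx _ zk wk; rewrite Rsym.
Qed.

End Clear.

(** * Assembling a villa partition *)

Section Build.
Variables (T : finType) (E : rel T).
Hypotheses (Esym : symmetric E) (Eirr : irreflexive E).
Local Notation R := (radj E).
Hypothesis noC4 : forall x y z w,
  R x y -> R y z -> R z w -> R w x -> R x z || R y w.

(** Sorting by decreasing number of neighbours in [X] is enough: sets comparable by inclusion are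
    ordered as their cardinals. *)
Lemma nested_sort (A X : {set T}) :
  (forall a b, a \in A -> b \in A ->
     nbr_in E a X \subset nbr_in E b X \/ nbr_in E b X \subset nbr_in E a X) ->
  exists s, [/\ uniq s, [set x in s] = A &
    pairwise (fun a b => nbr_in E b X \subset nbr_in E a X) s].
Proof.
move=> cmp; pose le a b := #|nbr_in E b X| <= #|nbr_in E a X|.
have le_tot : total le by move=> a b; exact: leq_total.
have le_tr : transitive le by move=> b a c ab bc; exact: leq_trans bc ab.
exists (sort le (enum A)); split.
- by rewrite sort_uniq enum_uniq.
- by apply/setP => x; rewrite inE mem_sort mem_enum.
have := sort_sorted le_tot (enum A); rewrite sorted_pairwise //.
apply: (sub_in_pairwise (P := mem A)); last first.
  by apply/allP => x; rewrite mem_sort mem_enum.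
move=> a b aA bA; rewrite /le => leab; case: (cmp a b aA bA) => // sab.
by have /eqP-> : nbr_in E a X == nbr_in E b X by rewrite eqEcard sab.
Qed.

(** Private neighbours [x] of [a] and [y] of [b] would close the chordless 4-cycle a, b, y, x. *)
Lemma nested_pair (A X : {set T}) :
  (forall a b, a \in A -> b \in A -> R a b) ->
  (forall x y, x \in X -> y \in X -> R x y) -> [disjoint A & X] ->
  forall a b, a \in A -> b \in A ->
    nbr_in E a X \subset nbr_in E b X \/ nbr_in E b X \subset nbr_in E a X.
Proof.
move=> Ac Xc dAX a b aA bA.
have RE c x : c \in A -> x \in X -> R c x = E c x.
  move=> cA xX; apply: R_E; apply: contraTneq xX => <-.
  by rewrite (disjointFr dAX).
case: (boolP (nbr_in E a X \subset nbr_in E b X)) => [|/subsetPn[x]]; first by left.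
rewrite !inE => /andP[xX ax]; rewrite xX /= => nbx; right.
apply/subsetP => y; rewrite !inE => /andP[yX by_]; rewrite yX /=.
have := noC4 (Ac _ _ aA bA) (_ : R b y) (Xc _ _ yX xX).
rewrite (Rsym Esym x a) !RE // => /(_ by_ ax).
by rewrite (negbTE nbx) orbF.
Qed.

(** Whatever some vertex of [A] sees, the first vertex of the chain sees too; as every vertex of [X]
    is seen from [A], the first vertex sees all of [X]. *)
Lemma nested_orderingP (A X : {set T}) :
  A != set0 ->
  (forall a b, a \in A -> b \in A -> R a b) ->
  (forall x y, x \in X -> y \in X -> R x y) -> [disjoint A & X] ->
  (forall x, x \in X -> exists2 a, a \in A & R a x) ->
  nested_ordering E A X /\
  ((forall a, a \in A -> exists2 x, x \in X & R a x) -> nested_ordering_ne E A X).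
Proof.
move=> /set0Pn[a0 a0A] Ac Xc dAX dom.
have RE c x : c \in A -> x \in X -> R c x = E c x.
  move=> cA xX; apply: R_E; apply: contraTneq xX => <-.
  by rewrite (disjointFr dAX).
have [s [su sA sp]] := nested_sort (nested_pair Ac Xc dAX).
have memA x : (x \in s) = (x \in A) by rewrite -sA inE.
case: s su sA sp memA => [|a s'] su sA sp memA.
  by move: a0A; rewrite -memA.
have top : nbr_in E a X = X.
  apply/setP => x; rewrite inE andb_idr // => xX.
  have [c cA] := dom x xX; rewrite RE // => cx; move: cA; rewrite -memA inE.
  case/orP=> [/eqP <-//|cs]; move: sp; rewrite pairwise_cons => /andP[/allP h _].
  by have /subsetP/(_ x) := h c cs; rewrite !inE xX cx => /(_ isT).
split; first by exists (a :: s').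
move=> ne; exists (a :: s'); do !split => //.
have lA : last a s' \in A by rewrite -memA mem_last.
have [x xX] := ne _ lA; rewrite RE // => lx.
by apply/set0Pn; exists x; rewrite inE xX.
Qed.

Lemma pairwise_enum (n : nat) (S : 'I_n -> {set T}) :
  (forall i j, i != j -> [disjoint S i & S j]) ->
  pairwise (fun P Q : {set T} => [disjoint P & Q]) [seq S i | i <- enum 'I_n].
Proof.
move=> d; rewrite pairwise_map.
have := enum_uniq 'I_n; rewrite uniq_pairwise; apply: sub_pairwise => i j.
exact: d.
Qed.

Lemma parts_pairwise (pre : seq {set T}) (n : nat) (B C : 'I_n -> {set T}) :
  pairwise (fun P Q : {set T} => [disjoint P & Q]) pre ->
  (forall P i, P \in pre -> [disjoint P & B i] && [disjoint P & C i]) ->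
  (forall i j, i != j -> [disjoint B i & B j]) ->
  (forall i j, i != j -> [disjoint C i & C j]) ->
  (forall i j, [disjoint B i & C j]) ->
  pairwise (fun P Q : {set T} => [disjoint P & Q])
    (pre ++ [seq B i | i <- enum 'I_n] ++ [seq C i | i <- enum 'I_n]).
Proof.
move=> dpre dP dB dC dBC; rewrite !pairwise_cat dpre !pairwise_enum //= !andbT.
apply/andP; split; apply/allrelP => P Q; last first.
  by move=> /mapP[i _ ->] /mapP[j _ ->].
move=> Ppre; rewrite mem_cat => /orP[] /mapP[i _ ->].
  by case/andP: (dP P i Ppre).
by case/andP: (dP P i Ppre).
Qed.

Lemma bigcup_parts (n : nat) (B C : 'I_n -> {set T}) :
  \bigcup_(P <- [seq B i | i <- enum 'I_n] ++ [seq C i | i <- enum 'I_n]) P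
  = (\bigcup_i B i) :|: (\bigcup_i C i).
Proof.
have bigE (S : 'I_n -> {set T}) :
    \bigcup_(P <- [seq S i | i <- enum 'I_n]) P = \bigcup_i S i.
  by rewrite big_map big_enum.
by rewrite big_cat !bigE.
Qed.

Lemma disjointI (A B : {set T}) :
  (forall x, x \in A -> x \in B -> False) -> [disjoint A & B].
Proof.
move=> h; rewrite -setI_eq0; apply/eqP/setP => x; rewrite !inE.
by apply/negP => /andP[/h].
Qed.

(** By [trB], adjacency is an equivalence on [Bc]; its classes are the [B i], and [C i] collects the
    neighbours of [B i] in [Cc]. By [BBC] a vertex of [Cc] has all its neighbours in [Bc] inside one
    class, so the [C i] are disjoint and see no other class. The classes of [b0], [b1], [b2] differ,
    whence t is at least 3. The clauses after the villa partition let the mansion case recognise the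
    class with index j*. *)
Lemma build_villa (A Bc Cc : {set T}) (b0 b1 b2 : T) :
  A != set0 ->
  [disjoint A & Bc] -> [disjoint A & Cc] -> [disjoint Bc & Cc] ->
  (forall x y, x \in A -> y \in A -> R x y) ->
  (forall x y, x \in A -> y \in Bc -> R x y) ->
  (forall x y, x \in A -> y \in Cc -> ~~ R x y) ->
  (forall x y, x \in Cc -> y \in Cc -> R x y) ->
  (forall x y z, x \in Bc -> y \in Bc -> z \in Bc -> R x y -> R y z -> R x z) ->
  (forall x y z, x \in Bc -> y \in Bc -> z \in Cc -> R x z -> R y z -> R x y) ->
  (forall x, x \in Bc -> exists2 y, y \in Cc & R x y) ->
  (forall y, y \in Cc -> exists2 x, x \in Bc & R x y) ->
  b0 \in Bc -> b1 \in Bc -> b2 \in Bc ->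
  ~~ R b0 b1 -> ~~ R b0 b2 -> ~~ R b1 b2 ->
  exists t (B C : 'I_t -> {set T}),
    [/\ 3 <= t, villa_partition E (A :|: (\bigcup_i B i) :|: (\bigcup_i C i)) A B C,
        \bigcup_i B i = Bc, \bigcup_i C i = Cc &
        [/\ forall i x y, x \in B i -> y \in Bc -> (y \in B i) = R x y,
          forall i x y, x \in B i -> y \in Cc -> R x y -> y \in C i,
          forall i y, y \in C i -> exists2 x, x \in B i & R x y,
          forall i j, i != j -> [disjoint B i & B j] &
          forall i j, i != j -> [disjoint C i & C j]] /\
        (forall i j, [disjoint B i & C j])].
Proof.
move=> A0 dAB dAC dBC AA AB AC CC trB BBC Bne Cne b0B b1B b2B n01 n02 n12.
pose cls x := [set y in Bc | R x y]; pose P := [set cls x | x in Bc].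
pose B (i : 'I_#|P|) : {set T} := enum_val i.
pose C (i : 'I_#|P|) : {set T} := [set y in Cc | [exists x in B i, R x y]].
have clsE i x : x \in B i -> x \in Bc /\ B i = cls x.
  have /imsetP[z zB Bz] := enum_valP i; rewrite {1}/B Bz inE => /andP[xB zx].
  split=> //; rewrite /B Bz; apply/setP => y; rewrite !inE.
  case yB: (y \in Bc) => //=; apply/idP/idP => [zy|xy]; last exact: trB zx xy.
  by apply: trB zy; rewrite // Rsym.
have memB i x y : x \in B i -> y \in Bc -> (y \in B i) = R x y.
  by case/clsE=> _ -> yB; rewrite inE yB.
have BsubBc i x : x \in B i -> x \in Bc by case/clsE.
have CsubCc i y : y \in C i -> y \in Cc by rewrite inE => /andP[].
have Bex x : x \in Bc -> exists i, x \in B i.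
  move=> xB; have cP : cls x \in P by apply: imset_f.
  by exists (enum_rank_in cP (cls x)); rewrite /B enum_rankK_in // inE xB Rxx.
have Beq i j x y : x \in B i -> y \in B j -> R x y -> i = j.
  move=> xi yj xy; have [xB Bi] := clsE _ _ xi; have [yB Bj] := clsE _ _ yj.
  rewrite -(memB i) // in xy; have [_ Biy] := clsE _ _ xy.
  by apply: enum_val_inj; rewrite -[LHS]/(B i) -[RHS]/(B j) Biy Bj.
have Bi0 i : exists x, x \in B i.
  have /imsetP[z zB Bz] := enum_valP i; exists z.
  by rewrite /B Bz inE zB Rxx.
have Bn0 i : B i != set0 by have [x xi] := Bi0 i; apply/set0Pn; exists x.
have Cmem i x y : x \in B i -> y \in Cc -> R x y -> y \in C i.
  by move=> xi yC xy; rewrite inE yC; apply/existsP; exists x; rewrite xi.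
have Cnbr i y : y \in C i -> exists2 x, x \in B i & R x y.
  by rewrite inE => /andP[_ /existsP[x /andP[]]]; exists x.
have Ceq i j x y : x \in B i -> y \in C j -> R x y -> i = j.
  move=> xi yj xy; have [z zj zy] := Cnbr _ _ yj.
  by apply: (Beq _ _ x z) => //; apply: (BBC _ _ y) => //; eauto.
have UB : \bigcup_i B i = Bc.
  apply/setP => x; apply/bigcupP/idP => [[i _ /BsubBc//]|/Bex[i xi]].
  by exists i.
have UC : \bigcup_i C i = Cc.
  apply/setP => y; apply/bigcupP/idP => [[i _ /CsubCc//]|yC].
  have [x xB xy] := Cne y yC; have [i xi] := Bex x xB.
  by exists i => //; apply: Cmem xy.
have dB i j : i != j -> [disjoint B i & B j].
  move=> nij; apply: disjointI => x xi xj; case/negP: nij; apply/eqP.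
  by apply: (Beq _ _ x x) => //; rewrite Rxx.
have dC i j : i != j -> [disjoint C i & C j].
  move=> nij; apply: disjointI => y yi yj; case/negP: nij; apply/eqP.
  by have [x xi xy] := Cnbr _ _ yi; apply: Ceq xy.
have dBiC i j : [disjoint B i & C j].
  apply: disjointI => x /BsubBc xB /CsubCc.
  by rewrite (disjointFr dBC).
exists #|P|, B, C; split=> //.
  have sub : [set cls b0; cls b1; cls b2] \subset P.
    by apply/subsetP => S; rewrite !inE => /orP[/orP[]|] /eqP->; apply: imset_f.
  have neq x y : x \in Bc -> y \in Bc -> ~~ R x y -> cls x != cls y.
    move=> xB yB; apply: contra => /eqP e.
    by have : y \in cls x by [rewrite e inE yB Rxx]; rewrite inE => /andP[].
  have := subset_leq_card sub; rewrite -setUA cardsU1 cards2 !inE.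
  by rewrite (negbTE (neq _ _ b0B b1B n01)) (negbTE (neq _ _ b0B b2B n02)) neq.
have sepE (x y : T) : ~~ R x y -> ~~ E x y by exact: nR_E.
have clqE (S : {set T}) : (forall x y, x \in S -> y \in S -> R x y) -> clique E S.
  by move=> h x y xS yS nxy; rewrite -R_E // h.
have cB i x y : x \in B i -> y \in B i -> R x y.
  by move=> xi yi; rewrite -(memB i) // (BsubBc i).
have cC i x y : x \in C i -> y \in C i -> R x y.
  by move=> /CsubCc xC /CsubCc; apply: CC.
have Cc_nbr i : exists y, y \in C i.
  have [x xi] := Bi0 i; have [y yC xy] := Bne x (BsubBc _ _ xi).
  by exists y; apply: Cmem xy.
do ![split].
- rewrite big_cons bigcup_parts /=; exact: setUA.
- apply: (@parts_pairwise [:: A]) => // S i; rewrite inE => /eqP->; apply/andP.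
  split; apply: disjointI => x xA.
    by move/BsubBc; rewrite (disjointFr dAB).
  by move/CsubCc; rewrite (disjointFr dAC).
- exact: A0.
- exact: clqE.
- exact: Bn0.
- by apply: clqE; exact: cB.
- by have [y yi] := Cc_nbr i; apply/set0Pn; exists y.
- by apply: clqE; exact: cC.
- move=> x y xA; rewrite UB => yB; rewrite -R_E ?AB //.
  by apply: contraTneq yB => <-; rewrite (disjointFr dAB).
- by move=> x y xA; rewrite UC => yC; apply/sepE/AC.
- move=> i j nij x y xi yj; apply: sepE; apply: contra nij => xy.
  by apply/eqP; apply: Beq xy.
- move=> i j nij x y xi yj; rewrite -R_E; first by apply: CC; eauto.
  by apply: contraTneq yj => <-; rewrite (disjointFr (dC _ _ nij)).
- move=> i j nij x y xi yj; apply: sepE; apply: contra nij => xy.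
  by apply/eqP; apply: Ceq xy.
- move=> i; have [_] := nested_orderingP (Bn0 i) (@cB i) (@cC i) (dBiC i i) (Cnbr i).
  apply=> x xi; have [y yC xy] := Bne x (BsubBc _ _ xi).
  by exists y => //; apply: Cmem xy.
Qed.
End Build.

(** * 5-baskets *)

Definition io (i : 'I_3) : idx := nth I0 idxs i.
Definition oi (i : idx) : 'I_3 :=
  match i with I0 => inord 0 | I1 => inord 1 | I2 => inord 2 end.

Lemma oiK i : io (oi i) = i.
Proof. by case: i; rewrite /io /oi inordK. Qed.

Lemma io_eq i j : ieq (io i) (io j) = (i == j).
Proof. by case: i j => [[|[|[|i]]] hi] [[|[|[|j]]] hj]. Qed.

Lemma ieqP i j : reflect (i = j) (ieq i j).
Proof. by case: i; case: j; constructor. Qed.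

Section InducedMat.
Variables (T : finType) (E : rel T).
Hypotheses (Esym : symmetric E) (Eirr : irreflexive E).

Lemma induced_mat (p : pattern) :
  has_induced E (graph_of_edges p.1 p.2) ->
  exists vs, mat E [::] vs = rows_of p.
Proof.
case: p => n es /= [f [injf Ef]]; exists [seq f i | i <- enum 'I_n].
have szf : size [seq f i | i <- enum 'I_n] = n by rewrite size_map size_enum_ord.
have szr : size (rows_of (n, es)) = n by rewrite size_map size_iota.
apply: (@eq_from_nth _ [::]); rewrite size_mat szf // => i lt_in.
have x0 := f (Ordinal lt_in).
have nthE j (jn : j < n) : nth x0 [seq f i | i <- enum 'I_n] j = f (Ordinal jn).
  rewrite (nth_map (Ordinal jn)) ?size_enum_ord //; congr f; apply: val_inj.
  by rewrite /= nth_enum_ord.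
rewrite (nth_mat E x0) ?szf // /rows_of /= (nth_map 0) ?size_iota // nth_iota //.
have sz : size (take i [seq f i | i <- enum 'I_n]) = i.
  by rewrite size_takel // szf ltnW.
apply: (@eq_from_nth _ false); rewrite /= !size_map ?size_iota sz // => j ji.
have jn := ltn_trans ji lt_in.
rewrite (nth_map x0) ?sz // (nth_map 0) ?size_iota // nth_iota // nth_take //.
rewrite !nthE R_E ?Ef //; apply: contraTneq ji => /injf[->]; by rewrite ltnn.
Qed.

End InducedMat.

Definition isAk0 k := if k is KAk I0 then true else false.
Definition isD0 k := if k is KD I0 then true else false.
Definition isFU k := isF k || isU k.
(** The trace of kind [KD i] is that of b_i without a, and the trace of kind [KAk i] is that of a
    without b_i. Accordingly the former joins B_i and the latter joins A in [inA]. *)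
Definition inB i k := match k with KB j | KD j => ieq i j | _ => false end.
Definition inC i k := if k is KC j then ieq i j else false.
Definition inA k := isA k || isAk k.
Definition basket_kind k :=
  [|| isA k, isAk0 k, isD0 k, isB k, isC k, isF k | isU k].

Section Cases.
Variables (T : finType) (E : rel T).
Hypotheses (Esym : symmetric E) (Eirr : irreflexive E).
Local Notation R := (radj E).
Hypothesis om0 : omits_all E fam0.
Hypothesis ns : forall v, ~ simplicial E v.
Variables (x0 : T) (p : seq T).
Hypothesis hp : mat E [::] p = Pm.
Local Notation kd := (kd E p).
Let fo P Q e := @forcedP T E Esym Eirr om0 x0 p hp P Q e.
Let ok0 xs := okxP Esym Eirr om0 x0 hp xs om0.

Lemma kd_exists (k : kind) : isA k || isB k || isC k -> exists x, kd x = k.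
Proof.
have kp i : i < 7 -> exists x, code (kd x) = [seq adjM Pm i j | j <- iota 0 7].
  by move=> i7; exists (nth x0 p i); exact: (kd_pent Esym Eirr om0 x0 hp).
move=> hk; have [n n7 cn] : exists2 n, n < 7 & code k = [seq adjM Pm n j | j <- iota 0 7].
  case: k hk => // [_|i _|i _]; first by exists 0.
    by case: i; [exists 1|exists 2|exists 3].
  by case: i; [exists 4|exists 5|exists 6].
have [x] := kp n n7; rewrite -cn => e; exists x; move: e.
by case: (kd x) => [||[]|[]|[]||[]|[]|[]|[]|[]||[]|]; case: k hk {cn} => // -[].
Qed.

Lemma kd_apex : kd (nth x0 p 0) = KA.
Proof.
have := kd_pent Esym Eirr om0 x0 hp (isT : 0 < 7).
by case: (kd _) => [||[]|[]|[]||[]|[]|[]|[]|[]||[]|].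
Qed.

Lemma kd_E (P : pred kind) x y : P (kd x) -> ~~ P (kd y) -> R x y -> E x y.
Proof. by move=> px py; rewrite R_E //; apply: contraNneq py => <-. Qed.

Lemma fo_E (P Q : pred kind) x y :
  forced P Q true -> P (kd x) -> Q (kd y) -> x != y -> E x y.
Proof. by move=> h px qy nxy; rewrite -R_E // (fo h). Qed.

Lemma fo_nE (P Q : pred kind) x y :
  forced P Q false -> P (kd x) -> Q (kd y) -> ~~ E x y.
Proof. by move=> h px qy; apply: nR_E; rewrite (fo h). Qed.

Section Basket.
Variable z : T.
Hypothesis zk : kd z = KAk I0 \/ kd z = KD I0.

(** The kind of [z] makes 1 the exceptional index i*: either [z] belongs to A and misses b_1, or it
    belongs to B_1 and misses a. The absence of [KY] makes the hypothesis of [no_pendant]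
    vacuous. *)
Lemma basket_noY y : kd y <> KY.
Proof. by move=> ky; case: zk => kz; refute (ok0 [:: z; y]). Qed.

Lemma basket_kindP x : basket_kind (kd x).
Proof.
have pend := @no_pendant T E Esym Eirr om0 ns x0 p hp.
have : ~~ pendant E p x by apply: pend => l y u _ /basket_noY.
have := no_spurious Esym Eirr om0 ns x0 hp x.
rewrite /pendant; case kx: (kd x) => [||i|i|i||i|i|i|i|i||i|] //=.
- move=> _ /forallPn[y]; rewrite negb_imply negbK.
  by case ky: (kd y) => // /andP[_]; have := basket_noY ky.
- by move=> _ _; case: zk => kz; refute (ok0 [:: z; x]).
- by move=> _ _; case: i kx => kx //; case: zk => kz; refute (ok0 [:: z; x]).
- by move=> _ _; case: i kx => kx //; case: zk => kz; refute (ok0 [:: z; x]).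
- by move=> _ _; case: zk => kz; refute (ok0 [:: z; x]).
Qed.

Lemma basket_AB x y j : kd x = KA -> kd y = KB j -> ~~ ieq j I0 -> R x y.
Proof. by move=> kx ky nj; case: zk => kz; refute (ok0 [:: z; x; y]). Qed.

Lemma basket_BC x y j : kd x = KB j -> kd y = KC j -> R x y.
Proof. by move=> kx ky; case: zk => kz; refute (ok0 [:: z; x; y]). Qed.

Lemma basket_DFU d a w :
  kd d = KD I0 -> kd a = KA -> R d a -> isFU (kd w) ->
  kd w <> KF I0 -> R d w.
Proof.
move=> kd1 ka da; case kw: (kd w) => // [i|] _ nF; last by refute (ok0 [:: d; a; w]).
by case: i kw nF => // kw _; refute (ok0 [:: d; a; w]).
Qed.

(** A vertex without such a neighbour falls to [minimal_contra], the clique being the vertices of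
    kinds [KF] and [KU]. The neighbour serves twice: it shows that every vertex of B_1 is seen from
    A, and through [basket_DFU] it joins [d] to F and to the universal vertices. *)
Lemma basket_D_A d : kd d = KD I0 -> exists2 a, kd a = KA & R d a.
Proof.
pose S d := isD0 (kd d) && [forall a, isA (kd a) ==> ~~ R d a].
have noS : forall d, ~~ S d.
  apply: (minimal_contra Esym Eirr om0 ns (W := fun x => isFU (kd x))).
    move=> w w'.
    have h : forced isFU isFU true by vm_compute.
    exact: (fo h).
  move=> v x y Sv vx vy nxy; have /andP[Dv /forallP noA] := Sv.
  pose notA k := basket_kind k && ~~ isA k.
  have nA w : R v w -> notA (kd w).
    move=> vw; rewrite /notA basket_kindP; apply/negP => Aw.
    by have := noA w; rewrite Aw vw.
  have : isD0 (kd x) && isFU (kd y) || isD0 (kd y) && isFU (kd x).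
    pose G (_ kx ky : kind) := isD0 kx && isFU ky || isD0 ky && isFU kx.
    have h : triple_forced fam0 isD0 notA notA G true true false by vm_compute.
    exact (triple_forcedP Esym Eirr om0 x0 hp om0 h Dv (nA _ vx) (nA _ vy) vx vy (negbTE nxy)).
  (* A neighbour of [s] of kind [KA] would force [s] to see [w], by [basket_DFU]; the exception
     [KF I0] is impossible for [w] because [v] sees it. *)
  have key s w : R v w -> ~~ R s w -> isD0 (kd s) -> isFU (kd w) -> S s.
    move=> vw nsw Ds Ww; rewrite /S Ds /=; apply/forallP => a; apply/implyP => Aa.
    apply: contra nsw => sa; apply: (@basket_DFU s a w) => //.
    - by case: (kd s) Ds => // -[].
    - by case: (kd a) Aa.
    - move=> kw; have kv : kd v = KD I0 by case: (kd v) Dv => // -[].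
      by move: vw; apply/negP; refute (ok0 [:: v; w]).
  case/orP=> /andP[Ds Ww]; apply/orP; [left|right]; rewrite Ww andbT.
    exact: key vy nxy Ds Ww.
  by apply: key vx _ Ds Ww; rewrite Rsym.
move=> kd1; have := noS d; rewrite /S kd1 /= => /forallPn[a].
rewrite negb_imply negbK => /andP[Aa da]; exists a => //.
by case: (kd a) Aa.
Qed.

Lemma basket_D0 x : isD (kd x) -> kd x = KD I0.
Proof. by have := basket_kindP x; case: (kd x) => // -[]. Qed.

Lemma basket_D_FU d w : isD (kd d) -> isFU (kd w) -> kd w <> KF I0 -> R d w.
Proof.
move=> /basket_D0 kd1 Ww nw; have [a ka da] := basket_D_A kd1.
exact: basket_DFU kd1 ka da Ww nw.
Qed.

Lemma basket_U x y : isU (kd x) -> ~~ isU (kd y) -> R x y.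
Proof.
move=> Ux nUy; case Dy: (isD (kd y)).
  by rewrite Rsym // basket_D_FU //; case: (kd x) Ux.
pose other k := [&& basket_kind k, ~~ isU k & ~~ isD k].
have h : forced isU other true by vm_compute.
by apply: (fo h) => //; rewrite /other basket_kindP nUy Dy.
Qed.

Lemma basket_A_B x y i : inA (kd x) -> inB i (kd y) -> ~~ ieq i I0 -> R x y.
Proof.
move=> Ax By ni; have := basket_kindP y; have := basket_kindP x.
case ky: (kd y) By => [|||||||j|j|||||] //= /ieqP eij; last first.
  rewrite {}eij in ni; case kx: (kd x) Ax => [||||k|||||||||] // _.
    by case: k kx => // kx _ _; refute (ok0 [:: x; y]).
  by move=> _ _; apply: basket_AB kx ky ni.
by rewrite eij in ni; case: j ky ni {eij}.
Qed.

Lemma basket_B_C x y i : inB i (kd x) -> inC i (kd y) -> R x y.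
Proof.
case kx: (kd x) => [|||||||j|j|||||] //= /ieqP ej; rewrite -{}ej in kx;
  case ky: (kd y) => [||||||||||||j'|] //= /ieqP ej; rewrite -{}ej in ky.
  by refute (ok0 [:: x; y]).
exact: basket_BC kx ky.
Qed.

Lemma basket_F_rest j x y :
  kd x = KF j -> [|| inA (kd y), isC (kd y) && ~~ inC j (kd y)
                   | (isB (kd y) || isD (kd y)) && ~~ inB j (kd y)] -> R x y.
Proof.
move=> kx; case Dy: (isD (kd y)).
  move=> h; rewrite Rsym // basket_D_FU // ?kx // => -[ej]; subst j.
  by move: h; rewrite (basket_D0 Dy).
pose P j k := [|| inA k && basket_kind k, isC k && ~~ inC j k | isB k && ~~ inB j k].
have h i : forced (fun k => if k is KF l then ieq i l else false) (P i) true.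
  by case: i; vm_compute.
rewrite orbF => Py; apply: (fo (h j)); first by rewrite kx; case: (j).
by rewrite /P basket_kindP andbT.
Qed.

Lemma basket_case : exists Q : {set T},
  is_5basket E Q /\ clique E (~: Q) /\ complete E (~: Q) Q.
Proof.
(* All vertices of F miss the same b_i and c_i, which gives j*; if F is empty, any index will do. *)
have [j jF] : exists j : 'I_3, forall f, isF (kd f) -> kd f = KF (io j).
  case: (pickP (fun f => isF (kd f))) => [f|noF]; last first.
    by exists ord0 => f; rewrite noF.
  case kf: (kd f) => [||||||||||l|||] // _; exists (oi l) => g.
  rewrite oiK; case kg: (kd g) => [||||||||||l'|||] // _.
  by case: (ieqP l' l) => [->//|]; case: l l' kf kg => -[] // kf kg _;
    refute (ok0 [:: f; g]).
exists [set x | ~~ isU (kd x)]; split; last first.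
  split=> [x y|x y]; rewrite !inE ?negbK => Ux Uy.
    by apply: (fo_E (P := isU) (Q := isU)) => //; vm_compute.
  exact: (kd_E Ux Uy (basket_U Ux Uy)).
pose A := [set x | inA (kd x)]; pose F := [set x | isF (kd x)].
pose B (i : 'I_3) := [set x | inB (io i) (kd x)].
pose C (i : 'I_3) := [set x | inC (io i) (kd x)].
exists A, B, C, F, ord0, j.
have UB x : (x \in \bigcup_i B i) = isB (kd x) || isD (kd x).
  apply/bigcupP/idP => [[i _]|]; first by rewrite inE; case: (kd x).
  case kx: (kd x) => [|||||||l|l|||||] //= _; exists (oi l) => //;
    by rewrite inE oiK kx; case: (l).
have UC x : (x \in \bigcup_i C i) = isC (kd x).
  apply/bigcupP/idP => [[i _]|]; first by rewrite inE; case: (kd x).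
  case kx: (kd x) => [||||||||||||l|] //= _; exists (oi l) => //.
  by rewrite inE oiK kx; case: (l).
have dis (P Q : pred kind) : (forall k, P k -> ~~ Q k) ->
    [disjoint [set x | P (kd x)] & [set x | Q (kd x)]].
  move=> h; apply: disjointI => x; rewrite !inE => /h /negP; exact.
have cliqueP (P : pred kind) : forced P P true -> clique E [set x | P (kd x)].
  by move=> h x y; rewrite !inE => px py; apply: fo_E h px py.
have [a ka] : exists a, kd a = KA by apply: kd_exists.
have AB0 : nested_ordering E A (B ord0).
  have C4 := R_C4 Esym Eirr om0.
  have [] := @nested_orderingP T E Esym C4 A (B ord0).
  - by apply/set0Pn; exists a; rewrite inE ka.
  - move=> x y; rewrite !inE.
    have h : forced inA inA true by vm_compute.
    exact: (fo h).
  - move=> x y; rewrite !inE.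
    have h : forced (inB (io ord0)) (inB (io ord0)) true by vm_compute.
    exact: (fo h).
  - by apply: dis => -[].
  (* A vertex of B_1 missing a has a neighbour in A by [basket_D_A]; any other one is seen by the
     apex of the pentagon. *)
  - move=> x; rewrite inE; case kx: (kd x) => [|||||||l|l|||||] //= h.
      have kx0 : kd x = KD I0 by apply: basket_D0; rewrite kx.
      by have [b kb xb] := basket_D_A kx0; exists b; rewrite ?inE ?kb // Rsym.
    exists (nth x0 p 0); last first.
      by rewrite Rsym // (R_pent Esym Eirr om0 x0 hp) // kx.
    by rewrite inE kd_apex.
  by [].
do ![split] => //.
- rewrite !big_cons bigcup_parts; apply/setP => x; rewrite !inE UB UC.
  by have := basket_kindP x; case: (kd x) => // -[].
- apply: (@parts_pairwise T [:: A; F]) => //=.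
  + by rewrite !andbT; apply: dis => -[].
  + move=> P i; rewrite !inE => /orP[] /eqP->; apply/andP.
      by split; apply: dis => -[].
    by split; apply: dis => -[].
  + move=> i k nik; apply: dis; rewrite -io_eq in nik.
    by case: (io i) (io k) nik => -[] // _ [] // [].
  + move=> i k nik; apply: dis; rewrite -io_eq in nik.
    by case: (io i) (io k) nik => -[] // _ [] // [].
  + by move=> i k; apply: dis => -[].
- by apply/set0Pn; exists a; rewrite inE ka.
- by apply: cliqueP; vm_compute.
- have [b kb] : exists b, kd b = KB (io i) by apply: kd_exists.
  by apply/set0Pn; exists b; rewrite inE kb; case: (io i).
- by apply: cliqueP; case: (io i); vm_compute.
- have [c kc] : exists c, kd c = KC (io i) by apply: kd_exists.
  by apply/set0Pn; exists c; rewrite inE kc; case: (io i).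
- by apply: cliqueP; case: (io i); vm_compute.
- by apply: cliqueP; vm_compute.
- move=> i k nik x y; rewrite !inE; apply: fo_nE; rewrite -io_eq in nik.
  by case: (io i) (io k) nik => [] []; vm_compute.
- move=> i k nik x y; rewrite !inE => Cx Cy; rewrite -io_eq in nik.
  apply: (kd_E Cx).
    by move: Cy; case: (kd y) => // l /ieqP <-.
  have h : forced isC isC true by vm_compute.
  by apply: (fo h); [case: (kd x) Cx | case: (kd y) Cy].
- move=> x y; rewrite inE => Ax; rewrite inE UB => /andP[nB0 By].
  apply: (kd_E Ax); first by case: (kd y) By.
  have [i Bi] : exists i, inB i (kd y).
    by case: (kd y) By => // l _; exists l; case: l.
  apply: (basket_A_B Ax Bi); move: nB0; rewrite inE.
  by case: (kd y) Bi => // l /ieqP <-; case: i.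
- move=> x y; rewrite inE UC; apply: fo_nE; by vm_compute.
- move=> i x y; rewrite !inE => Bx Cy; apply: (kd_E Bx).
    by case: (kd y) Cy.
  exact: basket_B_C Bx Cy.
- move=> i k nik x y; rewrite !inE; apply: fo_nE; rewrite -io_eq in nik.
  by case: (io i) (io k) nik => [] []; vm_compute.
- move=> x y; rewrite !inE !negb_or => Fx /andP[/andP[/andP[nB nC] nF] nU].
  apply: (kd_E Fx nF); apply: (basket_F_rest (jF _ Fx)).
  have := basket_kindP y; case: (kd y) nB nC nF nU => //= i _ nC _ _.
  by rewrite orbF.
- move=> x y; rewrite !inE => Fx; have kx := jF _ Fx; case/orP.
    apply: (fo_nE (P := fun k => if k is KF l then ieq l (io j) else false)).
      by case: (io j); vm_compute.
    by rewrite kx; case: (io j).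
  apply: (fo_nE (P := fun k => if k is KF l then ieq l (io j) else false)).
    by case: (io j); vm_compute.
  by rewrite kx; case: (io j).
Qed.

End Basket.
End Cases.

(** * Villas and mansions *)

Definition isX0 k := if k is KX I0 then true else false.
(** The kinds found in the B_i: [KX i] is a vertex of B_i that misses c_i, and [KL] one of a B_k
    away from the pentagon. In a mansion some [KX] form the clique X instead. Likewise, in [isCY],
    the kind [KY] covers vertices of C_i missing b_i, of a C_k away from the pentagon, and of Y. *)
Definition isBLX k := [|| isB k, isL k | isX k].
Definition isCY k := isC k || isY k.
Definition villa_kind k := [|| isA k, isBLX k, isCY k, isF k | isU k].

Definition kidx_b (i : idx) : nat := match i with I0 => 1 | I1 => 2 | I2 => 3 end.

Section VillaMansion.
Variables (T : finType) (E : rel T).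
Hypotheses (Esym : symmetric E) (Eirr : irreflexive E).
Local Notation R := (radj E).
Hypothesis om0 : omits_all E fam0.
Hypothesis omM : omits_all E famM.
Hypothesis ns : forall v, ~ simplicial E v.
Variables (x0 : T) (p : seq T).
Hypothesis hp : mat E [::] p = Pm.
Local Notation kd := (kd E p).
(* [m] selects the mansion case, where [f0] is a vertex of the clique F. *)
Variables (m : bool) (f0 : T).
Hypothesis mansionP : m -> kd f0 = KF I0.
Hypothesis villaP : ~~ m -> omits_all E famV.

Let fo P Q e := @forcedP T E Esym Eirr om0 x0 p hp P Q e.
Let ok0 xs := okxP Esym Eirr om0 x0 hp xs om0.
Let okM xs := okxP Esym Eirr om0 x0 hp xs omM.
Let okV nm xs := okxP Esym Eirr om0 x0 hp xs (villaP nm).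

(** For contradictions available in both cases: with [f0] added to the search in the mansion case,
    with [patF] forbidden otherwise. *)
Ltac refute_both xs :=
  let h := fresh in
  have [h|h] := boolP m;
    [have ? := mansionP h; refute (okM (f0 :: xs)) | refute (okV h xs)].

Lemma kd_F f : isF (kd f) -> m /\ kd f = KF I0.
Proof.
case kf: (kd f) => [||||||||||i|||] // _; have [hm|nm] := boolP m.
  split=> //; have k0 := mansionP hm.
  by case: i kf => // kf; refute (okM [:: f0; f]).
by refute (okV nm [:: f]).
Qed.

Lemma L_U l y u : kd l = KL -> kd y = KY -> kd u = KU -> R l y -> R l u.
Proof. by move=> kl ky ku ly; refute_both [:: l; y; u]. Qed.

Lemma no_pend x : ~~ pendant E p x.
Proof. exact: (no_pendant Esym Eirr om0 ns x0 hp L_U). Qed.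

Lemma villa_kindP x : villa_kind (kd x).
Proof.
have := no_pend x; have := no_spurious Esym Eirr om0 ns x0 hp x; rewrite /pendant.
case kx: (kd x) => [||i|i|i||i|i|i|i|i||i|] //= _ _.
  by refute (okM [:: x]).
by refute (okM [:: x]).
Qed.

Lemma L_Y l : kd l = KL -> exists2 y, kd y = KY & R l y.
Proof.
move=> kl; have := no_pend l; rewrite /pendant kl /= => /forallPn[y].
rewrite negb_imply negbK => /andP[]; case ky: (kd y) => // _.
by exists y.
Qed.

(* The vertices of the clique X of the mansion. *)
Definition extraX x := m && isX0 (kd x).

Lemma extraX_kind x : extraX x -> m /\ kd x = KX I0.
Proof. by case/andP=> ->; case: (kd x) => // -[]. Qed.

(** A vertex of B_i missing c_i must still see something in C_i, and those that do not are
    eliminated by minimality. Members of the clique X truly have no neighbour in the C_i, hence the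
    exclusion of [extraX]. *)
Lemma X_C x i : kd x = KX i -> ~~ extraX x -> exists2 c, kd c = KC i & R x c.
Proof.
pose S v := [&& isX (kd v), ~~ extraX v & [forall c, isC (kd c) ==> ~~ R v c]].
have noS : forall v, ~~ S v.
  apply: (minimal_contra Esym Eirr om0 ns (W := fun x => isW (kd x))).
    move=> w w'.
    have h : forced isW isW true by vm_compute.
    exact: (fo h).
  move=> v a b Sv va vb nab; have /and3P[Xv nev /forallP noC] := Sv.
  pose nbr k := villa_kind k && ~~ isC k.
  have nbrP w : R v w -> nbr (kd w).
    move=> vw; rewrite /nbr villa_kindP; apply/negP => Cw.
    by have := noC w; rewrite Cw vw.
  have : isX (kd a) && isW (kd b) || isX (kd b) && isW (kd a).
    (* The search exempts a vertex of kind [KX i] with a neighbour of kind [KF i]. Since [KF I0] is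
       the only kind in F, and occurs only in the mansion case, [nev] excludes it here. *)
    pose sameXF k k' := match k, k' with KX i, KF j => ieq i j | _, _ => false end.
    pose G kv kx ky := [|| sameXF kv kx, sameXF kv ky | isX kx && isW ky || isX ky && isW kx].
    have noXF w : ~~ sameXF (kd v) (kd w).
      apply/negP => vw; have Fw : isF (kd w) by case: (kd v) (kd w) vw => // i' [].
      have [hm kw] := kd_F Fw; move: nev vw; rewrite /extraX hm kw.
      by case: (kd v) => // -[].
    have h : triple_forced famM isX nbr nbr G true true false by vm_compute.
    have := triple_forcedP Esym Eirr om0 x0 hp omM h Xv (nbrP _ va) (nbrP _ vb) va vb (negbTE nab).
    by rewrite /G !(negbTE (noXF _)) {h}.
  have key s w : R v s -> ~~ R s w -> isX (kd s) -> isW (kd w) -> S s.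
    move=> vs nsw Xs Ww; rewrite /S Xs /=; apply/andP; split.
      case ks: (kd s) Xs => [|||k||||||||||] // _.
      case kv: (kd v) Xv => [|||j||||||||||] // _.
      move: nev; rewrite /extraX kv ks; case: (ieqP k j) => [->//|].
      by case: k j ks kv => -[] // ks kv _ _; exfalso; move: vs; apply/negP; refute (ok0 [:: v; s]).
    apply/forallP => c; apply/implyP => Cc; apply: contra nsw => sc.
    case ks: (kd s) Xs => [|||k||||||||||] // _.
    case kc: (kd c) Cc => [||||||||||||j|] // _.
    by case kw: (kd w) Ww => [|||||||||||||] // _; refute (okM [:: s; c; w]).
  case/orP=> /andP[Xs Ww]; apply/orP; [left|right]; rewrite Ww andbT.
    exact: key va nab Xs Ww.
  by apply: key vb _ Xs Ww; rewrite Rsym.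
move=> kx nex; have := noS x; rewrite /S kx nex /= => /forallPn[c].
rewrite negb_imply negbK => /andP[]; case kc: (kd c) => [||||||||||||j|] // _ xc.
exists c => //; have [->//|nij] := ieqP i j.
by case: i j kx kc nij => -[] // kx kc _; exfalso; move: xc; apply/negP; refute (ok0 [:: x; c]).
Qed.

(** For [KL] and [KX] the search is run with a third vertex: a neighbour of kind [KY], one of kind
    [KC], or [f0] when [x] is in the clique X. *)
Lemma A_BLX a x : kd a = KA -> isBLX (kd x) -> R a x.
Proof.
move=> ka; case kx: (kd x) => [||i|i|i||i|i|i|i|i||i|] // _.
- by have [y ky xy] := L_Y kx; refute (okM [:: a; x; y]).
- have [ex|nex] := boolP (extraX x).
    have [hm kx0] := extraX_kind ex; have kf := mansionP hm.
    by clear i kx; refute (okM [:: f0; a; x]).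
  by have [c kc xc] := X_C kx nex; refute (okM [:: a; x; c]).
- by refute (okM [:: a; x]).
Qed.

(** This and [inCc] set apart the cliques X and Y of a mansion: a vertex of kind [KY] counts for the
    C_i exactly if it is seen from the B_i, and the remaining ones will form Y. *)
Definition inBc x := isBLX (kd x) && ~~ extraX x.
Definition inCc x := isC (kd x) || isY (kd x) && [exists b, inBc b && R b x].

Lemma U_Y1 u y x : kd u = KU -> kd y = KY -> inBc x -> R x y -> R u y.
Proof.
move=> ku ky; case/andP; case kx: (kd x) => [||i|i|i||i|i|i|i|i||i|] // _ _ xy;
  refute_both [:: x; y; u].
Qed.

(** Without F there is no clique Y: vertices of kind [KY] unseen from the B_i fall to
    [minimal_contra], the clique being the vertices of kind [KU]. *)
Lemma Y_Bc y : ~~ m -> kd y = KY -> exists2 x, inBc x & R x y.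
Proof.
move=> nm; pose S y := isY (kd y) && ~~ [exists x, inBc x && R x y].
have nF f : ~~ isF (kd f) by apply: contra nm => /kd_F[].
have noS : forall v, ~~ S v.
  apply: (minimal_contra Esym Eirr om0 ns (W := fun x => isU (kd x))).
    move=> w w'.
    have h : forced isU isU true by vm_compute.
    exact: (fo h).
  move=> v a b Sv va vb nab; have /andP[Yv /existsPn noB] := Sv.
  pose nbr k := [&& villa_kind k, ~~ isBLX k & ~~ isF k].
  have nbrP w : R v w -> nbr (kd w).
    move=> vw; rewrite /nbr villa_kindP nF andbT; apply/negP => Bw.
    by have := noB w; rewrite /inBc /extraX Bw (negbTE nm) Rsym // vw.
  have : isY (kd a) && isU (kd b) || isY (kd b) && isU (kd a).
    pose G (_ kx ky : kind) := isY kx && isU ky || isY ky && isU kx.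
    have h : triple_forced fam0 isY nbr nbr G true true false by vm_compute.
    exact (triple_forcedP Esym Eirr om0 x0 hp om0 h Yv (nbrP _ va) (nbrP _ vb) va vb (negbTE nab)).
  have key s w : ~~ R s w -> isY (kd s) -> isU (kd w) -> S s.
    move=> nsw Ys Uw; rewrite /S Ys /=; apply: contra nsw => /existsP[x /andP[xB xs]].
    by rewrite Rsym // (@U_Y1 w s x) //; [case: (kd w) Uw | case: (kd s) Ys].
  case/orP=> /andP[Ys Uw]; apply/orP; [left|right]; rewrite Uw andbT.
    exact: key nab Ys Uw.
  by apply: key _ Ys Uw; rewrite Rsym.
move=> ky; have := noS y; rewrite /S ky /= negbK => /existsP[x /andP[xB xy]].
by exists x.
Qed.

Lemma U_all u x : isU (kd u) -> R u x.
Proof.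
case ku: (kd u) => // _; have := villa_kindP x.
case kx: (kd x) => [||i|i|i||i|i|i|i|i||i|] // _.
- by have [y ky xy] := L_Y kx; rewrite Rsym // (L_U kx ky ku xy).
- have [ex|nex] := boolP (extraX x).
    have [hm kx0] := extraX_kind ex; have kf := mansionP hm.
    by clear i kx; refute (okM [:: f0; u; x]).
  by have [c kc xc] := X_C kx nex; refute (okM [:: u; x; c]).
- by refute (ok0 [:: u; x]).
- by refute (ok0 [:: u; x]).
- by refute (ok0 [:: u; x]).
- have [hm|nm] := boolP m.
    by have kf := mansionP hm; refute (okM [:: f0; u; x]).
  by have [b bB bx] := Y_Bc nm kx; apply: U_Y1 bB bx.
- by refute (ok0 [:: u; x]).
- by refute (ok0 [:: u; x]).
Qed.

Lemma kd_base (i : idx) :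
  (exists b, kd b = KB i /\ forall x, R x b = nth false (code (kd x)) (kidx_b i)) /\
  (exists c, kd c = KC i /\ forall x, R x c = nth false (code (kd x)) (3 + kidx_b i)).
Proof.
have kp := kd_pent Esym Eirr om0 x0 hp; have rp := R_pent Esym Eirr om0 x0 hp.
split.
  exists (nth x0 p (kidx_b i)); split; last by move=> x; apply: rp; case: i.
  have := kp (kidx_b i); case: i => /(_ isT);
    by case: (kd _) => [||[]|[]|[]||[]|[]|[]|[]|[]||[]|].
exists (nth x0 p (3 + kidx_b i)); split; last by move=> x; apply: rp; case: i.
have := kp (3 + kidx_b i); case: i => /(_ isT);
  by case: (kd _) => [||[]|[]|[]||[]|[]|[]|[]|[]||[]|].
Qed.

Definition setA := [set x | isA (kd x)].
Definition setB := [set x | inBc x].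
Definition setC := [set x | inCc x].

Lemma disjoint_kd (P Q : pred kind) (S S' : {set T}) :
  (forall k, P k -> ~~ Q k) -> (forall x, x \in S -> P (kd x)) ->
  (forall x, x \in S' -> Q (kd x)) -> [disjoint S & S'].
Proof.
by move=> h hS hS'; apply: disjointI => x /hS/h/negP nq /hS'.
Qed.

Lemma inCcP x : inCc x -> isCY (kd x).
Proof. by rewrite /isCY => /orP[->|/andP[-> _]]; rewrite ?orbT. Qed.

(** Common to both cases; for a mansion it is the villa left after removing F, X, Y and the
    universal vertices. *)
Lemma villa_parts : exists t (B C : 'I_t -> {set T}),
    [/\ 3 <= t,
        villa_partition E (setA :|: (\bigcup_i B i) :|: (\bigcup_i C i)) setA B C,
        \bigcup_i B i = setB, \bigcup_i C i = setC &
        [/\ forall i x y, x \in B i -> y \in setB -> (y \in B i) = R x y,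
          forall i x y, x \in B i -> y \in setC -> R x y -> y \in C i,
          forall i y, y \in C i -> exists2 x, x \in B i & R x y,
          forall i j, i != j -> [disjoint B i & B j] &
          forall i j, i != j -> [disjoint C i & C j]] /\
        (forall i j, [disjoint B i & C j])].
Proof.
have BP x : x \in setB -> isBLX (kd x) by rewrite inE => /andP[].
have CP x : x \in setC -> isCY (kd x) by rewrite inE => /inCcP.
have AP x : x \in setA -> isA (kd x) by rewrite inE.
have tri V P Q e1 e2 e3 : triple_forced fam0 V P Q (fun _ _ _ => false) e1 e2 e3 ->
    forall v x y, V (kd v) -> P (kd x) -> Q (kd y) ->
    R v x = e1 -> R v y = e2 -> R x y = e3 -> False.
  move=> h v x y vV xP yQ r1 r2 r3.
  by have := triple_forcedP Esym Eirr om0 x0 hp om0 h vV xP yQ r1 r2 r3.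
have exB i : exists2 b, b \in setB & kd b = KB i.
  have [[b [kb _]] _] := kd_base i; exists b; rewrite // inE /inBc /extraX kb /=.
  by rewrite andbF.
have [b0 b0B k0] := exB I0; have [b1 b1B k1] := exB I1; have [b2 b2B k2] := exB I2.
have nonadj i j x y : kd x = KB i -> kd y = KB j -> ~~ ieq i j -> ~~ R x y.
  by move=> kx ky nij; refute (ok0 [:: x; y]).
apply: (@build_villa T E Esym (R_C4 Esym Eirr om0) _ _ _ b0 b1 b2) => //.
- by apply/set0Pn; exists (nth x0 p 0); rewrite inE (kd_apex Esym Eirr om0 x0 hp).
- by apply: disjoint_kd AP BP => -[].
- by apply: disjoint_kd AP CP => -[].
- by apply: disjoint_kd BP CP => -[].
- move=> x y /AP Ax /AP Ay; have h : forced isA isA true by vm_compute.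
  exact: (fo h Ax Ay).
- by move=> x y /AP Ax /BP; apply: A_BLX; case: (kd x) Ax.
- move=> x y /AP Ax /CP Cy; have h : forced isA isCY false by vm_compute.
  by rewrite (fo h Ax Cy).
- move=> x y /CP Cx /CP Cy; have h : forced isCY isCY true by vm_compute.
  exact: (fo h Cx Cy).
- move=> x y z /BP Bx /BP By /BP Bz xy yz; apply: contraT => /negbTE nxz; exfalso.
  have h : triple_forced fam0 isBLX isBLX isBLX (fun _ _ _ => false) true true false.
    by vm_compute.
  by rewrite Rsym // in xy; exact: (tri _ _ _ _ _ _ h y x z).
- move=> x y z /BP Bx /BP By /CP Cz xz yz; apply: contraT => /negbTE nxy; exfalso.
  have h : triple_forced fam0 isCY isBLX isBLX (fun _ _ _ => false) true true false.
    by vm_compute.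
  by rewrite Rsym // in xz; rewrite Rsym // in yz; exact: (tri _ _ _ _ _ _ h z x y).
- move=> x; rewrite inE => Bx; have /andP[Px nex] := Bx.
  case kx: (kd x) Px => [|||i|||||i|||||] // _.
  + have [y ky xy] := L_Y kx; exists y; rewrite // inE /inCc ky /=.
    by apply/existsP; exists x; rewrite Bx.
  + by have [c kc xc] := X_C kx nex; exists c; rewrite // inE /inCc kc.
  + have [_ [c [kc xc]]] := kd_base i; exists c; first by rewrite inE /inCc kc.
    by rewrite xc kx; destruct i.
- move=> y; rewrite inE; case/orP => [Cy|/andP[_ /existsP[x /andP[xB xy]]]].
    case ky: (kd y) Cy => [||||||||||||i|] // _.
    have [[b [kb yb]] _] := kd_base i; exists b.
      by rewrite inE /inBc /extraX kb /= andbF.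
    by rewrite Rsym // yb ky; destruct i.
  by exists x; rewrite // inE.
- exact: nonadj k0 k1 _.
- exact: nonadj k0 k2 _.
- exact: nonadj k1 k2 _.
Qed.

Lemma universal_rest : clique E (~: [set x | ~~ isU (kd x)]) /\
  complete E (~: [set x | ~~ isU (kd x)]) [set x | ~~ isU (kd x)].
Proof.
split=> [x y|x y]; rewrite !inE ?negbK => Ux Uy.
  by move=> nxy; rewrite -R_E // U_all.
exact: (kd_E Ux Uy (U_all _ Ux)).
Qed.

Lemma villa_case : ~~ m -> exists Q : {set T},
  is_villa E Q /\ clique E (~: Q) /\ complete E (~: Q) Q.
Proof.
move=> nm; exists [set x | ~~ isU (kd x)]; split; last exact: universal_rest.
have [t [B [C [t3 vp UB UC _]]]] := villa_parts.
exists t; split=> //; exists setA, B, C; suff -> : [set x | ~~ isU (kd x)] =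
  setA :|: \bigcup_i B i :|: \bigcup_i C i by [].
rewrite UB UC; apply/setP => x; rewrite !inE /inBc /inCc /extraX (negbTE nm).
have := villa_kindP x; have := @kd_F x; have := @Y_Bc x nm.
case: (kd x) => //=.
- by move=> i _ /(_ isT) [hm]; rewrite hm in nm.
- move=> /(_ erefl) [b bB bx] _ _; apply/esym/existsP; exists b.
  by rewrite bx andbT.
Qed.

Definition isB0 k := if k is KB I0 then true else false.
Definition isC0 k := if k is KC I0 then true else false.

Lemma mansion_case : m -> exists Q : {set T},
  is_mansion E Q /\ clique E (~: Q) /\ complete E (~: Q) Q.
Proof.
move=> hm; have kf := mansionP hm.
exists [set x | ~~ isU (kd x)]; split; last exact: universal_rest.
have [t [B [C [t3 vp UB UC [[memB memC Cnbr dB dC] dBC]]]]] := villa_parts.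
have [[b [kb Rb]] _] := kd_base I0.
have BsubP i x : x \in B i -> inBc x.
  by move=> xi; have : x \in setB by [rewrite -UB; apply/bigcupP; exists i]; rewrite inE.
have CsubP i x : x \in C i -> inCc x.
  by move=> xi; have : x \in setC by [rewrite -UC; apply/bigcupP; exists i]; rewrite inE.
have bB : b \in setB by rewrite inE /inBc /extraX kb /= andbF.
(* The index j* is that of the class of b_1, which [f0], being of kind [KF I0], misses. *)
have [j bj] : exists j, b \in B j by move: bB; rewrite -UB => /bigcupP[j]; exists j.
(* All vertices of kind [KX I0] went to X, so only kind [KB I0] remains in the class of b_1. *)
have inBj x : inBc x -> (x \in B j) = isB0 (kd x).
  move=> xB; rewrite (memB j b x) ?inE // Rsym // Rb.
  case/andP: xB; rewrite /extraX hm.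
  by case: (kd x) => [||i|i|i||i|i|i|i|i||i|] // _; case: i.
have BjP x : x \in B j -> isB0 (kd x).
  by move=> xj; rewrite -(inBj x (BsubP _ _ xj)).
have BiP i x : i != j -> x \in B i -> inBc x && ~~ isB0 (kd x).
  move=> nij xi; rewrite (BsubP i) //= -(inBj x (BsubP _ _ xi)).
  by rewrite (disjointFr (dB _ _ nij)).
have CiP i y : i != j -> y \in C i -> inCc y && ~~ isC0 (kd y).
  move=> nij yi; rewrite (CsubP i) //=; apply/negP => y0.
  have : y \in C j.
    apply: (memC j b) => //; first by rewrite inE (CsubP i).
    by rewrite Rsym // Rb; case: (kd y) y0 => // -[].
  by rewrite (disjointFr (dC _ _ nij)).
(* A vertex of C_j of kind [KY] would form a forbidden graph with [f0], its neighbour in B_j and the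
   pentagon. *)
have CjP y : y \in C j -> isC0 (kd y).
  move=> yj; have [x xj xy] := Cnbr _ _ yj.
  have kx : kd x = KB I0 by have := BjP _ xj; case: (kd x) => // -[].
  have := inCcP (CsubP _ _ yj).
  case ky: (kd y) => [||||||||||||i|] // _.
    by exfalso; move: xy; apply/negP; refute (okM [:: f0; x; y]).
  by case: i ky => ky //; exfalso; move: xy; apply/negP; refute (ok0 [:: x; y]).
pose X := [set x | extraX x].
pose Y := [set x | isY (kd x) && ~~ [exists b, inBc b && R b x]].
pose F := [set x | isF (kd x)].
have FP x : x \in F -> kd x = KF I0 by rewrite inE => /kd_F[].
have XP x : x \in X -> kd x = KX I0 by rewrite inE => /extraX_kind[].
have YP x : x \in Y -> kd x = KY by rewrite inE => /andP[]; case: (kd x).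
have AP x : x \in setA -> kd x = KA by rewrite inE; case: (kd x).
have clq (P : pred kind) (S : {set T}) : forced P P true ->
    (forall x, x \in S -> P (kd x)) -> clique E S.
  by move=> h hS x y /hS px /hS py; apply: fo_E h px py.
have cpl (S S' : {set T}) (P Q : pred kind) :
    (forall x, x \in S -> P (kd x)) -> (forall x, x \in S' -> Q (kd x)) ->
    (forall k, P k -> ~~ Q k) -> forced P Q true -> complete E S S'.
  move=> hS hS' hk h x y /hS Px /hS' Qy; apply: (kd_E Px _ (fo h Px Qy)).
  by apply: contraL Qy; exact: hk.
have acpl (S S' : {set T}) (P Q : pred kind) :
    (forall x, x \in S -> P (kd x)) -> (forall x, x \in S' -> Q (kd x)) ->
    forced P Q false -> anticomplete E S S'.
  by move=> hS hS' h x y /hS Px /hS' Qy; apply: fo_nE h Px Qy.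
pose isF0 k := if k is KF I0 then true else false.
have F0 x : x \in F -> isF0 (kd x) by move/FP->.
have X0 x : x \in X -> isX0 (kd x) by move/XP->.
have Y0 x : x \in Y -> isY (kd x) by move/YP->.
have A0 x : x \in setA -> isA (kd x) by move/AP->.
have f0F : f0 \in F by rewrite inE kf.
exists t; split=> //; exists setA, B, C, F, X, Y, j.
move: (villa_partition _ _ _ _ _) vp => VP vp; do ![split] => //.
- rewrite !big_cons bigcup_parts UB UC; apply/setP => x.
  rewrite !inE /inCc; set e := [exists b, _]; rewrite /inBc /extraX hm.
  by have := villa_kindP x; case: (kd x) => //= [i|] _; [case: i | case: e].
- have dk (P Q : pred kind) (S S' : {set T}) := @disjoint_kd P Q S S'.
  have Bk i x : x \in B i -> isBLX (kd x) by move/BsubP => /andP[].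
  have Ck i x : x \in C i -> isCY (kd x) by move/CsubP/inCcP.
  apply: (@parts_pairwise T [:: setA; F; X; Y]) => //=.
  + rewrite !andbT (dk _ _ _ _ _ A0 F0) ?(dk _ _ _ _ _ A0 X0) ?(dk _ _ _ _ _ A0 Y0);
      try by case.
    rewrite (dk _ _ _ _ _ F0 X0) ?(dk _ _ _ _ _ F0 Y0) ?(dk _ _ _ _ _ X0 Y0) //; by case.
  + move=> P i; rewrite !inE => /or4P[] /eqP->; apply/andP; split.
    * by apply: dk A0 (Bk i) => -[].
    * by apply: dk A0 (Ck i) => -[].
    * by apply: dk F0 (Bk i) => -[].
    * by apply: dk F0 (Ck i) => -[].
    * by apply: disjointI => x; rewrite inE => ex /BsubP /andP[_]; rewrite ex.
    * by apply: dk X0 (Ck i) => -[].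
    * by apply: dk Y0 (Bk i) => -[].
    * apply: disjointI => x; rewrite inE => /andP[Yx /negbTE nb] /CsubP.
      by rewrite /inCc nb andbF orbF; case: (kd x) Yx.
- by apply/set0Pn; exists f0.
- by apply: clq F0; vm_compute.
- by apply: clq X0; vm_compute.
- by apply: clq Y0; vm_compute.
- by apply: cpl F0 A0 _ _; [case | vm_compute].
- move=> x y xF /bigcupP[i nij /(BiP _ _ nij) /andP[/andP[yB nex] y0]].
  have kx := FP _ xF; apply: (kd_E (F0 _ xF)); first by case: (kd y) yB.
  case ky: (kd y) yB y0 => [|||i'|||||i'|||||] // _ y0.
  + by have [c kc yc] := L_Y ky; refute (okM [:: x; y; c]).
  + have [c kc yc] := X_C ky nex; clear f0F kf.
    by refute (okM [:: x; y; c]).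
  + by case: i' ky y0 => // ky _; refute (ok0 [:: x; y]).
- move=> x y xF /bigcupP[i nij /(CiP _ _ nij) /andP[/inCcP yC y0]].
  pose P k := isCY k && ~~ isC0 k.
  have h : forced isF0 P true by vm_compute.
  apply: (kd_E (F0 _ xF)); first by case: (kd y) yC.
  by apply: (fo h (F0 _ xF)); rewrite /P yC.
- have BCj x : x \in B j :|: C j -> isB0 (kd x) || isC0 (kd x).
    by rewrite inE => /orP[/BjP->|/CjP->]; rewrite ?orbT.
  by apply: (acpl _ _ isF0 (fun k => isB0 k || isC0 k) F0 BCj); vm_compute.
- move=> x y xB yC; have Bx := BjP _ xB; have Cy := CjP _ yC.
  apply: (kd_E Bx); first by case: (kd y) Cy.
  have kx : kd x = KB I0 by case: (kd x) Bx => // -[].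
  have ky : kd y = KC I0 by case: (kd y) Cy => // -[].
  by refute (okM [:: f0; x; y]).
- move=> x y xX; rewrite inE => /orP[yA|/BjP yB].
    apply: (kd_E (X0 _ xX)); first by rewrite AP.
    by rewrite Rsym // A_BLX ?(AP _ yA) ?(XP _ xX).
  have h : forced isX0 isB0 true by vm_compute.
  apply: (kd_E (X0 _ xX)); first by case: (kd y) yB.
  exact: (fo h (X0 _ xX)).
- apply: (acpl _ _ isX0 (fun k => [&& isBLX k, ~~ isB0 k & ~~ isX0 k]) X0); last by vm_compute.
  move=> y /bigcupP[i nij /(BiP _ _ nij) /andP[/andP[yB nex] y0]].
  by move: nex; rewrite yB y0 /extraX hm.
- move=> x y xX /bigcupP[i _ /CsubP /inCcP yC].
  have kx := XP _ xX; case y0: (isC0 (kd y)).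
    have ky : kd y = KC I0 by case: (kd y) y0 => // -[].
    by apply: nR_E; refute (okM [:: f0; x; y]).
  have h : forced isX0 (fun k => isCY k && ~~ isC0 k) false by vm_compute.
  by apply: nR_E; rewrite (fo h (X0 _ xX)) // yC y0.
- apply: (cpl _ _ isF0 (fun k => isX0 k || isY k) F0) => [x||]; last by vm_compute.
    by rewrite inE => /orP[/X0->|/Y0->]; rewrite ?orbT.
  by case=> // -[].
- by apply: acpl X0 Y0 _; vm_compute.
- move=> x y xY /bigcupP[i _ /CsubP yC]; rewrite -R_E.
    have h : forced isY isCY true by vm_compute.
    exact: (fo h (Y0 _ xY) (inCcP yC)).
  apply: contraTneq yC => <-; move: xY; rewrite inE /inCc => /andP[Yx /negbTE->].
  by rewrite andbF orbF; case: (kd x) Yx.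
- move=> x y xY; rewrite inE => /orP[/A0 yA|/bigcupP[i _ /BsubP yB]].
    have h : forced isY isA false by vm_compute.
    by apply: nR_E; rewrite (fo h (Y0 _ xY)).
  apply: nR_E; apply/negP => xy; move: xY; rewrite inE => /andP[_ /existsPn/(_ y)].
  by rewrite yB Rsym // xy.
Qed.

End VillaMansion.

(** * Excluding patterns by labellings *)

Section Labelling.
Variables (pt : nat -> nat -> bool -> bool).
Variables (tr : nat -> nat -> nat -> bool -> bool -> bool -> bool).
Variables (nl : nat) (fin : seq nat -> bool) (e : nat -> nat -> bool).

Definition fits_label (i k : nat) (ks : seq nat) : bool :=
  allb (fun j => if pt k (nth 0 ks j) (e i j) then
    allb (fun l => tr k (nth 0 ks j) (nth 0 ks l) (e i j) (e i l) (e j l)) (iota 0 j)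
    else false) (iota 0 i).

Fixpoint labelling (n : nat) (ks : seq nat) : bool :=
  if n is n'.+1 then
    anyb (fun k => if fits_label (size ks) k ks then labelling n' (rcons ks k)
                   else false) (iota 0 nl)
  else fin ks.

(** In contrast to [embP], completeness is needed here: a labelling that exists must be found, so
    that a failed search excludes it. *)
Lemma labellingP (g : nat -> nat) n :
  (forall i, i < n -> g i < nl) ->
  (forall i j, j < i < n -> pt (g i) (g j) (e i j)) ->
  (forall i j l, l < j < i -> i < n ->
     tr (g i) (g j) (g l) (e i j) (e i l) (e j l)) ->
  fin (mkseq g n) -> labelling n [::].
Proof.
move=> gl gp gt gf.
suff step d k : d + k = n -> labelling d (mkseq g k) by apply: (step n 0); rewrite addn0.
elim: d k => [k|d IH k]; first by rewrite add0n => ->.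
rewrite addSn -addnS => dk /=; rewrite anybE; apply/hasP; exists (g k).
  by rewrite mem_iota /= gl // -dk leq_addl.
have kn : k < n by rewrite -dk leq_addl.
rewrite -mkseqS // IH //; case: ifP => // /negP[]; rewrite /fits_label allbE.
rewrite size_mkseq; apply/allP => j; rewrite mem_iota /= => jk.
rewrite nth_mkseq // gp ?jk // allbE; apply/allP => l; rewrite mem_iota /= => lj.
by rewrite nth_mkseq ?(ltn_trans lj) // gt ?lj.
Qed.

End Labelling.

Section LabelledGraph.
Variables (T : finType) (E : rel T).
Hypotheses (Esym : symmetric E).
Variables (pt : nat -> nat -> bool -> bool).
Variables (tr : nat -> nat -> nat -> bool -> bool -> bool -> bool).
Variables (nl : nat) (lab : T -> nat).
Hypothesis lab_lt : forall x, lab x < nl.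
Hypothesis lab_pt : forall x y, x != y -> pt (lab x) (lab y) (E x y).
Hypothesis lab_tt : forall x y z, x != y -> x != z -> y != z ->
  tr (lab x) (lab y) (lab z) (E x y) (E x z) (E y z).

(** With [fin] constantly true this excludes the pattern outright; otherwise it confines its copies
    to the labellings that [fin] rejects. *)
Lemma labelled_omits (p : pattern) (fin : seq nat -> bool) :
  ~~ labelling pt tr nl fin (edges_rel p.2) p.1 [::] ->
  forall f : 'I_p.1 -> T, injective f ->
  (forall x y, E (f x) (f y) = graph_of_edges p.1 p.2 x y) ->
  ~~ fin [seq lab (f i) | i <- enum 'I_p.1].
Proof.
case: p => n es /= no f injf Ef; apply: contra no => hf.
case: n => [|n] in f injf Ef hf *; first by rewrite enum_ord0 in hf.
pose h i := f (inord i); have injh i j : j < i < n.+1 -> h i != h j.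
  case/andP=> ji ni; have nj := ltn_trans ji ni.
  apply/eqP => /injf/(congr1 val) /=; rewrite !inordK // => e.
  by rewrite e ltnn in ji.
have Eh i j : j < i < n.+1 -> E (h i) (h j) = edges_rel es i j.
  by case/andP=> ji ni; have nj := ltn_trans ji ni; rewrite Ef /graph_of_edges !inordK.
apply: (@labellingP _ _ _ _ _ (lab \o h)) => [i _|i j ij|i j l /andP[lj ji] ni|] /=.
- exact: lab_lt.
- by rewrite -Eh // lab_pt ?injh.
- have li := ltn_trans lj ji; have nj := ltn_trans ji ni; rewrite -!Eh ?ji ?li ?lj //.
  by rewrite lab_tt ?injh ?ji ?li ?lj.
rewrite /mkseq -val_enum_ord -map_comp.
by rewrite (eq_map (g := lab \o f)) // => i; rewrite /= /h inord_val.
Qed.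

End LabelledGraph.

(* Entries of a label table: 0 nonadjacent, 1 adjacent, 2 unconstrained. *)
Definition tab_pt (tab : nat -> nat -> nat) (k l : nat) (e : bool) : bool :=
  match tab k l with 0 => ~~ e | 1 => e | _ => true end.

Definition no_tt (k l m : nat) (a b c : bool) : bool := true.

(* Labels 1 and 2 stand for the [B_i]'s and the [C_i]'s of a villa. *)
Definition villa_tt (k l m : nat) (a b c : bool) : bool :=
  let isB k := k == 1 in let isBC k := (k == 1) || (k == 2) in
  [&& [&& isBC k, isB l, isB m, a & b] ==> c,
      [&& isBC l, isB k, isB m, a & c] ==> b &
      [&& isBC m, isB k, isB l, b & c] ==> a].

(** The four rotations of a 4-cycle with two consecutive vertices in part [P] and the other two in
    part [Q]. The tables leave the adjacency between these parts open, so only nestedness can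
    exclude them. *)
Definition c4_labels (P Q : nat) : seq (seq nat) :=
  [:: [:: P; P; Q; Q]; [:: P; Q; Q; P]; [:: Q; P; P; Q]; [:: Q; Q; P; P]].

Fact excludes_key : unit. Proof. exact: tt. Qed.

(* Locked, so that [done] does not run the search. *)
Definition excludes pt tr (fin : seq nat -> bool) (p : pattern) : bool :=
  locked_with excludes_key (~~ labelling pt tr 9 fin (edges_rel p.2) p.1 [::]).

Lemma excludesE pt tr fin p :
  excludes pt tr fin p = ~~ labelling pt tr 9 fin (edges_rel p.2) p.1 [::].
Proof. by rewrite /excludes unlock. Qed.

Definition labels_refute pt tr (P Q : nat) : bool :=
  all (excludes pt tr predT) [:: pat2P3; patC6; patC7; patT0] &&
  excludes pt tr (fun ks => ks \notin c4_labels P Q) patC4.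

(* Labels: A, B_i (i <> j), C_i (i <> j), B_j, C_j, F, X, Y, universal. *)
Definition villa_tab (k l : nat) : nat := nth 1 (nth [::]
  [:: [:: 1; 1; 0; 1; 0; 1; 1; 0];
      [:: 1; 2; 2; 0; 0; 1; 0; 0];
      [:: 0; 2; 1; 0; 1; 1; 0; 1];
      [:: 1; 0; 0; 1; 1; 0; 1; 0];
      [:: 0; 0; 1; 1; 1; 0; 0; 1];
      [:: 1; 1; 1; 0; 0; 1; 1; 1];
      [:: 1; 0; 0; 1; 0; 1; 1; 0];
      [:: 0; 0; 1; 0; 1; 1; 0; 1]] k) l.

(** One table serves villas and mansions, for every t: a villa simply leaves the parts from label 3
    on empty. *)
Lemma villa_refute : labels_refute (tab_pt villa_tab) villa_tt 1 2.
Proof. by rewrite /labels_refute /= !excludesE; vm_compute. Qed.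

(* Labels: A, B_1, B_2, B_3, C_1, C_2, C_3, F, universal. *)
Definition basket_tab (i j k l : nat) : nat :=
  let ab n := if n == i then 2 else 1 in let f n : nat := n != j in
  nth 1 (nth [::]
  [:: [:: 1; ab 0; ab 1; ab 2; 0; 0; 0; 1];
      [:: ab 0; 1; 0; 0; 1; 0; 0; f 0];
      [:: ab 1; 0; 1; 0; 0; 1; 0; f 1];
      [:: ab 2; 0; 0; 1; 0; 0; 1; f 2];
      [:: 0; 1; 0; 0; 1; 1; 1; f 0];
      [:: 0; 0; 1; 0; 1; 1; 1; f 1];
      [:: 0; 0; 0; 1; 1; 1; 1; f 2];
      [:: 1; f 0; f 1; f 2; f 0; f 1; f 2; 1]] k) l.

(** The label of the clique B_{i*}, the only one with open adjacency to A, is [i.+1] because A has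
    label 0. *)
Lemma basket_refute (i j : 'I_3) :
  labels_refute (tab_pt (basket_tab i j)) no_tt 0 i.+1.
Proof.
rewrite /labels_refute /= !excludesE.
by case: i j => [[|[|[|i]]] hi] [[|[|[|j]]] hj]; vm_compute.
Qed.

(** * Forbidden subgraphs of a graph described by a table of parts *)

Section Labelled.
Variables (T : finType) (E : rel T).
Hypotheses (Esym : symmetric E) (Eirr : irreflexive E).

(** Entry 1 exempts equal vertices, so that on the diagonal of a table it says that the part is a
    clique. *)
Definition entry (v : nat) (X Y : {set T}) : Prop :=
  match v with
  | 0 => anticomplete E X Y
  | 1 => forall x y, x \in X -> y \in Y -> x != y -> E x y
  | _ => True
  end.

Variables (tab : nat -> nat -> nat) (tr : nat -> nat -> nat -> bool -> bool -> bool -> bool).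
Variables (P Q : nat) (parts : seq {set T}).
Hypothesis size_parts : size parts = 8.
Definition lab (x : T) : nat := find (fun S : {set T} => x \in S) parts.
Hypothesis tab_sym : forall k l, tab k l = tab l k.
Hypothesis tab8 : forall k, tab k 8 = 1.
Hypothesis entryP : forall k l, k <= l < 8 ->
  entry (tab k l) (nth set0 parts k) (nth set0 parts l).
Hypothesis univ : forall x y, lab x = 8 -> x != y -> E x y.
Hypothesis ttP : forall x y z, x != y -> x != z -> y != z ->
  tr (lab x) (lab y) (lab z) (E x y) (E x z) (E y z).
Hypothesis cross : forall x y u w,
  x \in nth set0 parts P -> y \in nth set0 parts P ->
  u \in nth set0 parts Q -> w \in nth set0 parts Q ->
  E x y -> E u w -> E y u -> E x w -> E x u || E y w.
Hypotheses (P8 : P < 8) (Q8 : Q < 8).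
Hypothesis refuted : labels_refute (tab_pt tab) tr P Q.

Lemma mem_lab x : lab x < 8 -> x \in nth set0 parts (lab x).
Proof. by rewrite -size_parts -has_find => /(nth_find set0). Qed.

Lemma lab_lt9 x : lab x < 9.
Proof. by rewrite ltnS -size_parts find_size. Qed.

Lemma lab_tab x y : x != y -> tab_pt tab (lab x) (lab y) (E x y).
Proof.
wlog le_xy : x y / lab x <= lab y => [wl nxy|nxy].
  case/orP: (leq_total (lab x) (lab y)) => h; first exact: wl.
  by rewrite /tab_pt tab_sym Esym; apply: wl => //; rewrite eq_sym.
have := lab_lt9 y; rewrite ltnS leq_eqVlt => /orP[/eqP y8|y8].
  by rewrite /tab_pt y8 tab8 Esym univ // eq_sym.
have := @entryP (lab x) (lab y); rewrite le_xy y8 => /(_ isT).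
have xm := mem_lab (leq_ltn_trans le_xy y8); have ym := mem_lab y8.
by rewrite /tab_pt /entry; case: (tab _ _) => [|[|n]] // h; apply: h.
Qed.

Lemma labelled_fam0 p : p \in fam0 -> omits E p.
Proof.
have /andP[/and5P[r2 r6 r7 rT _] r4] := refuted.
have om q : excludes (tab_pt tab) tr predT q -> omits E q.
  rewrite excludesE => h [f [injf Ef]].
  by have := labelled_omits lab_lt9 lab_tab ttP h injf Ef.
suff o4 : omits E patC4.
  rewrite !inE => /orP[/eqP->|]; first exact o4.
  case/or4P=> /eqP->; [exact (om _ r2)|exact (om _ r6)|exact (om _ r7)|exact (om _ rT)].
move: r4; rewrite excludesE => r4 [f [injf Ef]].
have := labelled_omits lab_lt9 lab_tab ttP r4 injf Ef; rewrite negbK {om r2 r6 r7 rT r4}.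
pose v i : T := f (inord i).
have -> : [seq lab (f i) | i <- enum 'I_4] = [:: lab (v 0); lab (v 1); lab (v 2); lab (v 3)].
  rewrite -[RHS]/[seq lab (v i) | i <- iota 0 4] -val_enum_ord -map_comp.
  by apply: eq_map => i; rewrite /= /v inord_val.
have Ev i j : i < 4 -> j < 4 -> E (v i) (v j) = edges_rel patC4.2 i j.
  by move=> i4 j4; rewrite Ef /graph_of_edges !inordK.
(* The four remaining labellings are rotations of the cycle x, y, u, w with x, y in part [P] and u,
   w in part [Q]; there [cross] yields a chord. *)
have spurious x y u w : lab x = P -> lab y = P -> lab u = Q -> lab w = Q ->
    E x y -> E u w -> E y u -> E x w -> ~~ E x u -> ~~ E y w -> False.
  move=> lx ly lu lw xy uw yu xw /negbTE nxu /negbTE nyw.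
  have mem z k : lab z = k -> k < 8 -> z \in nth set0 parts k.
    by move=> <-; exact: mem_lab.
  by have := cross (mem _ _ lx P8) (mem _ _ ly P8) (mem _ _ lu Q8) (mem _ _ lw Q8) xy uw yu xw;
    rewrite nxu nyw.
rewrite !inE => /or4P[] /eqP[l0 l1 l2 l3].
- by apply: (spurious (v 0) (v 1) (v 2) (v 3)); rewrite ?Ev.
- by apply: (spurious (v 3) (v 0) (v 1) (v 2)); rewrite ?Ev.
- by apply: (spurious (v 1) (v 2) (v 3) (v 0)); rewrite ?Ev.
- by apply: (spurious (v 2) (v 3) (v 0) (v 1)); rewrite ?Ev.
Qed.

End Labelled.

(** * From partitions to property (a) *)

Lemma pairwise_mem (T : eqType) (r : rel T) s x y :
  pairwise r s -> x \in s -> y \in s -> [|| x == y, r x y | r y x].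
Proof.
elim: s => //= a s IH /andP[/allP ra /IH{}IH]; rewrite !inE.
case/orP=> [/eqP->|xs] /orP[/eqP->|ys]; rewrite ?eqxx ?(ra _ xs) ?(ra _ ys) ?orbT //.
exact: IH.
Qed.

Section Parts.
Variable (T : finType).

Lemma parts_pairwise_inv (pre : seq {set T}) (n : nat) (B C : 'I_n -> {set T}) :
  pairwise (fun P Q : {set T} => [disjoint P & Q])
    (pre ++ [seq B i | i <- enum 'I_n] ++ [seq C i | i <- enum 'I_n]) ->
  [/\ pairwise (fun P Q : {set T} => [disjoint P & Q]) pre,
      forall P i, P \in pre -> [disjoint P & B i] && [disjoint P & C i],
      forall i j, i != j -> [disjoint B i & B j],
      forall i j, i != j -> [disjoint C i & C j] &
      forall i j, [disjoint B i & C j]].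
Proof.
have sep (S : 'I_n -> {set T}) :
    pairwise (fun P Q : {set T} => [disjoint P & Q]) [seq S i | i <- enum 'I_n] ->
    forall i j, i != j -> [disjoint S i & S j].
  rewrite pairwise_map => h i j nij.
  have := pairwise_mem h (mem_enum _ i) (mem_enum _ j).
  by rewrite (negbTE nij) /= (disjoint_sym (S j)) orbb.
rewrite !pairwise_cat => /and3P[/allrelP dpre dp /and3P[/allrelP dBC /sep dB /sep dC]].
split=> // [P i Pp|i j].
  by rewrite !dpre // mem_cat map_f ?orbT ?mem_enum.
by rewrite dBC // map_f ?mem_enum.
Qed.

End Parts.

Section Good.
Variables (T : finType) (E : rel T).
Hypotheses (Esym : symmetric E) (Eirr : irreflexive E).
Local Notation R := (radj E).

(** Property (a) of the whole graph, together with what makes [Q] a nontrivial anticomponent once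
    the rest is known to be universal. *)
Definition admissible (Q : {set T}) : Prop :=
  [/\ forall p, p \in fam0 -> omits E p, has_induced E pentagon3,
      forall v, ~ simplicial E v, anticonnected E Q & 1 < #|Q|].

Lemma pairwise_cross (A X : {set T}) (s : seq T) :
  [set x in s] = A ->
  pairwise (fun a b => nbr_in E b X \subset nbr_in E a X) s ->
  forall x y u w, x \in A -> y \in A -> u \in X -> w \in X ->
    E y u -> E x w -> E x u || E y w.
Proof.
move=> sA sp x y u w; rewrite -sA !inE => xs ys uX wX yu xw.
case/or3P: (pairwise_mem sp xs ys) => [/eqP->|/subsetP/(_ u)|/subsetP/(_ w)].
- by rewrite yu.
- by rewrite !inE uX yu => /(_ isT) /= ->.
- by rewrite !inE wX xw => /(_ isT) /= ->; rewrite orbT.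
Qed.

Lemma nested_orderingE (A X : {set T}) : nested_ordering E A X ->
  (exists2 a, a \in A & forall x, x \in X -> E a x) /\
  (forall x y u w, x \in A -> y \in A -> u \in X -> w \in X ->
    E y u -> E x w -> E x u || E y w).
Proof.
case=> s [us [sA [sp h]]]; split; last exact: pairwise_cross sA sp.
case: s us sA sp h => // a s us sA sp top; exists a; first by rewrite -sA !inE eqxx.
by move=> x; rewrite -{1}top inE => /andP[].
Qed.

Lemma nested_ordering_neE (A X : {set T}) : nested_ordering_ne E A X ->
  [/\ exists2 a, a \in A & forall x, x \in X -> E a x,
      forall a, a \in A -> exists2 x, x \in X & E a x &
      forall x y u w, x \in A -> y \in A -> u \in X -> w \in X ->
        E y u -> E x w -> E x u || E y w].
Proof.
case=> s [us [sA [sp h]]]; split; last exact: pairwise_cross sA sp.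
  case: s us sA sp h => // a s us sA sp [top _].
  exists a; first by rewrite -sA !inE eqxx.
  by move=> x; rewrite -{1}top inE => /andP[].
move=> b; rewrite -sA inE; case: s us {sA} sp h => // a s _ sp [_ /set0Pn[x]].
rewrite inE => /andP[xX lx] bs; exists x => //.
(* The last vertex of the chain has the smallest neighbourhood, so its neighbour [x] is seen by
   every [b]. *)
rewrite lastI pairwise_rcons in sp; case/andP: sp => /allP al _.
move: bs; rewrite lastI mem_rcons inE => /orP[/eqP->//|/al/subsetP/(_ x)].
by rewrite !inE xX lx => /(_ isT).
Qed.

Lemma R_dis (X Y : {set T}) : anticomplete E X Y -> [disjoint X & Y] ->
  forall x y, x \in X -> y \in Y -> ~~ R x y.
Proof.
move=> ac d x y xX yY; rewrite /radj negb_or ac // andbT.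
by apply: contraTneq yY => <-; rewrite (disjointFr d).
Qed.

Lemma not_simplicial v x y : E v x -> E v y -> ~~ R x y -> ~ simplicial E v.
Proof.
move=> vx vy /norP[nxy /negP nE] h; apply: nE.
by apply: h; rewrite ?inE.
Qed.

Lemma pentagonP (a : T) (b c : 'I_3 -> T) :
  (forall i, E a (b i)) -> (forall i, ~~ R a (c i)) ->
  (forall i, E (b i) (c i)) ->
  (forall i j, i != j -> ~~ R (b i) (b j)) ->
  (forall i j, i != j -> E (c i) (c j)) ->
  (forall i j, i != j -> ~~ R (b i) (c j)) -> has_induced E pentagon3.
Proof.
move=> ab ac bc bb cc bc'.
pose o k : 'I_3 := inord k; have no i j : i < 3 -> j < 3 -> i != j -> o i != o j.
  by move=> i3 j3; apply: contraNneq => /(congr1 val) /=; rewrite !inordK // => ->.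
pose p := [:: a; b (o 0); b (o 1); b (o 2); c (o 0); c (o 1); c (o 2)].
apply: (@realized_induced _ _ Esym Eirr patP3 (nth a p)) => //.
have mp : mat E [::] p = Pm.
  have bb' i j : i < 3 -> j < 3 -> i != j -> R (b (o i)) (b (o j)) = false.
    by move=> *; apply/negbTE/bb/no.
  have bc2 i j : i < 3 -> j < 3 -> i != j -> R (c (o i)) (b (o j)) = false.
    by move=> *; rewrite Rsym //; apply/negbTE/bc'; rewrite eq_sym no.
  have cc' i j : i < 3 -> j < 3 -> i != j -> R (c (o i)) (c (o j)).
    by move=> *; apply/ER/cc/no.
  rewrite /= !(Rsym Esym _ a) !(ER (ab _)) !(negbTE (ac _)).
  have bcd i : R (c i) (b i) by rewrite Rsym // ER.
  by rewrite !bcd !bb' // !cc' // !bc2.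
move=> i j /andP[ji i7]; have j7 := ltn_trans ji i7.
rewrite -(adj_mat Esym a) // mp.
by do 7?[case: i ji i7 => [|i] ji i7 //]; do 7?[case: j ji j7 => [|j] ji j7 //].
Qed.

Definition co (Q : {set T}) : rel T :=
  fun u v => [&& u \in Q, v \in Q, u != v & ~~ E u v].

Lemma coR (Q : {set T}) u v : u \in Q -> v \in Q -> ~~ R u v -> connect (co Q) u v.
Proof. by move=> uQ vQ /norP[nuv nE]; apply: connect1; rewrite /co uQ vQ nuv. Qed.

Lemma co_sym Q : connect_sym (co Q).
Proof.
apply: sym_connect_sym => u v; rewrite /co eq_sym Esym.
by case: (u \in Q); case: (v \in Q).
Qed.

Lemma anticonnected_from (Q : {set T}) a :
  (forall x, x \in Q -> connect (co Q) x a) -> anticonnected E Q.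
Proof.
move=> h x y xQ yQ; apply: connect_trans (h x xQ) _.
by rewrite -/(co Q) co_sym; exact: h.
Qed.

Lemma card_gt1 (Q : {set T}) x y : x \in Q -> y \in Q -> ~~ R x y -> 1 < #|Q|.
Proof. by move=> xQ yQ /nR_neq nxy; apply/card_gt1P; exists x, y. Qed.

(** * Properties of a villa, alone or inside a mansion *)

Section VillaFacts.
Variables (t : nat) (Q A : {set T}) (B C : 'I_t -> {set T}).
Hypothesis t3 : 3 <= t.
Hypothesis vp : villa_partition E Q A B C.

Lemma villa_facts :
  [/\ Q = A :|: ((\bigcup_i B i) :|: (\bigcup_i C i)),
      exists a, a \in A,
      forall i, [/\ clique E A, clique E (B i) & clique E (C i)],
      (forall i a b, a \in A -> b \in B i -> E a b) /\
      (forall i a c, a \in A -> c \in C i -> ~~ R a c) &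
      [/\ forall i j x y, i != j -> x \in B i -> y \in B j -> ~~ R x y,
          forall i j x y, i != j -> x \in C i -> y \in C j -> E x y,
          forall i j x y, i != j -> x \in B i -> y \in C j -> ~~ R x y &
          forall i, [/\ exists2 b, b \in B i & forall c, c \in C i -> E b c,
            forall b, b \in B i -> exists2 c, c \in C i & E b c,
            exists c, c \in C i &
            forall x y u w, x \in B i -> y \in B i -> u \in C i -> w \in C i ->
              E y u -> E x w -> E x u || E y w]]].
Proof.
have [[QU pw] [A0 [Ac [BCc [AB [AC [BB [CC [BC nest]]]]]]]]] := vp.
have [_ dA dB dC dBC] := parts_pairwise_inv (pre := [:: A]) pw.
split.
- by rewrite -QU big_cons bigcup_parts.
- by case/set0Pn: A0 => a; exists a.
- by move=> i; have [_ [Bc [_ Cc]]] := BCc i.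
- split=> i a x aA xi; first by apply: AB => //; apply/bigcupP; exists i.
  have /andP[_ d] := dA A i (mem_head _ _).
  by apply: R_dis d _ _ aA xi => u v uA vi; apply: AC => //; apply/bigcupP; exists i.
- split.
  + by move=> i j x y nij; apply: R_dis; [apply: BB | apply: dB].
  + by move=> i j x y nij; apply: CC.
  + by move=> i j x y nij; apply: R_dis; [apply: BC | apply: dBC].
  + move=> i; have [h1 h2 h3] := nested_ordering_neE (nest i); split=> //.
    by have [_ [_ [/set0Pn[c ci] _]]] := BCc i; exists c.
Qed.

Lemma idx_ne (i : 'I_t) : exists j, i != j.
Proof.
have t0 : 0 < t by apply: leq_trans t3.
have t1 : 1 < t by apply: leq_trans t3.
have [e|] := eqVneq i (Ordinal t0); last by exists (Ordinal t0).
by exists (Ordinal t1); rewrite e.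
Qed.

Lemma villa_pentagon : has_induced E pentagon3.
Proof.
have [_ [a aA] _ [AB AC] [BB CC BC nest]] := villa_facts.
pose o (k : 'I_3) : 'I_t := widen_ord t3 k.
(* Choosing b_i complete to C_i allows any vertex of C_i as c_i. *)
have bx i : exists x, (x \in B i) && [forall c, (c \in C i) ==> E x c].
  have [[x xi h] _ _ _] := nest i; exists x; rewrite xi /=.
  by apply/forallP => c; apply/implyP; exact: h.
have cx i : exists x, x \in C i by have [_ _ [c ci] _] := nest i; exists c.
pose b k := xchoose (bx (o k)); pose c k := xchoose (cx (o k)).
have bB k : b k \in B (o k) by have /andP[] := xchooseP (bx (o k)).
have cC k : c k \in C (o k) by exact: xchooseP (cx (o k)).
have no i j : i != j -> o i != o j by apply: contraNneq => /(congr1 val) /= /val_inj->.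
apply: (@pentagonP a b c) => [i|i|i|i j /no n|i j /no n|i j /no n].
- exact: AB aA (bB i).
- exact: AC aA (cC i).
- have /andP[_ /forallP/(_ (c i))] := xchooseP (bx (o i)).
  by rewrite cC.
- exact: BB n (bB i) (bB j).
- exact: CC n (cC i) (cC j).
- exact: BC n (bB i) (cC j).
Qed.

(** Nonadjacent neighbours: for a vertex of A, one in each of two B_i; for one of B_i, a vertex of A
    and a neighbour in C_i; for one of C_i, a vertex of B_i complete to C_i and a vertex of another
    C_j. *)
Lemma villa_not_simplicial v : v \in Q -> ~ simplicial E v.
Proof.
have [-> [a aA] cl [AB AC] [BB CC BC nest]] := villa_facts.
have bx i : exists b, b \in B i by have [[b bi _] _ _ _] := nest i; exists b.
rewrite !inE; case/orP=> [vA|/orP[] /bigcupP[i _ vi]].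
- have t0 : 0 < t by apply: leq_trans t3.
  have [j n] := idx_ne (Ordinal t0); have [x xi] := bx (Ordinal t0).
  have [y yj] := bx j.
  exact: (not_simplicial (AB _ _ _ vA xi) (AB _ _ _ vA yj) (BB _ _ _ _ n xi yj)).
- have [_ /(_ v vi)[c ci vc] _ _] := nest i.
  by apply: (not_simplicial _ vc (AC _ _ _ aA ci)); rewrite Esym (AB i).
- have [j n] := idx_ne i; have [[b bi bC] _ _ _] := nest i; have [_ _ [c cj] _] := nest j.
  apply: (@not_simplicial v b c); last exact: BC n bi cj.
    by rewrite Esym bC.
  exact: CC n vi cj.
Qed.

(** In the complement, A is joined to every C_i, and B_i to each C_j with j different from i. The
    superset [S] allows reuse inside a mansion. *)
Lemma villa_connect (S : {set T}) : Q \subset S ->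
  exists2 a, a \in A & forall x, x \in Q -> connect (co S) x a.
Proof.
have [-> [a aA] cl [AB AC] [BB CC BC nest]] := villa_facts.
move=> /subsetP QS; exists a => // x.
have aS : a \in S by rewrite QS // !inE aA.
have cx i : exists c, c \in C i by have [_ _ [c ci] _] := nest i; exists c.
have CS i c : c \in C i -> c \in S.
  by move=> ci; apply: QS; rewrite !inE; apply/or3P/Or33/bigcupP; exists i.
have BS i b : b \in B i -> b \in S.
  by move=> bi; apply: QS; rewrite !inE; apply/or3P/Or32/bigcupP; exists i.
have ca i c : c \in C i -> connect (co S) c a.
  move=> ci; apply: coR => //; first exact: CS ci.
  by rewrite Rsym // (AC i).
rewrite !inE; case/orP=> [xA|/orP[] /bigcupP[i _ xi]].
- have t0 : 0 < t by apply: leq_trans t3.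
  have [c ci] := cx (Ordinal t0); apply: connect_trans (ca _ _ ci).
  apply: coR; [|exact: CS ci|exact: AC xA ci].
  by apply: QS; rewrite !inE xA.
- have [j n] := idx_ne i; have [c cj] := cx j; apply: connect_trans (ca _ _ cj).
  by apply: coR; [exact: BS xi|exact: CS cj|exact: BC n xi cj].
- exact: ca xi.
Qed.

(** The edges xy, yu and xw force a common index, and the nested neighbourhoods for that index give
    the chord. *)
Lemma villa_cross x y u w :
  x \in \bigcup_i B i -> y \in \bigcup_i B i ->
  u \in \bigcup_i C i -> w \in \bigcup_i C i ->
  E x y -> E u w -> E y u -> E x w -> E x u || E y w.
Proof.
have [_ _ _ _ [BB _ BC nest]] := villa_facts.
case/bigcupP=> i _ xi /bigcupP[j _ yj] /bigcupP[k _ uk] /bigcupP[l _ wl] xy _ yu xw.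
have eij : i = j by apply/eqP; apply: contraT => /BB/(_ xi yj); rewrite ER.
have ejk : j = k by apply/eqP; apply: contraT => /BC/(_ yj uk); rewrite ER.
have eil : i = l by apply/eqP; apply: contraT => /BC/(_ xi wl); rewrite ER.
subst; have [_ _ _ cr] := nest l; exact: cr.
Qed.

(** A vertex of B_i or C_i has neighbours in no other B_k, and B_i is a clique. This is what
    [villa_tt] retains after the index is forgotten. *)
Lemma villa_close x y z :
  x \in (\bigcup_i B i) :|: (\bigcup_i C i) ->
  y \in \bigcup_i B i -> z \in \bigcup_i B i ->
  E x y -> E x z -> y != z -> E y z.
Proof.
have [_ _ cl _ [BB _ BC nest]] := villa_facts => xBC.
case/bigcupP=> j _ yj /bigcupP[k _ zk] xy xz nyz.
have [i xi] : exists i, forall l u, u \in B l -> E x u -> i = l.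
  move: xBC; rewrite inE => /orP[] /bigcupP[i _ xi]; exists i => l u ul xu.
    by apply/eqP; apply: contraT => /BB/(_ xi ul); rewrite ER.
  apply/eqP; rewrite eq_sym; apply: contraT => /BC/(_ ul xi).
  by rewrite Rsym // ER.
have ej := xi _ _ yj xy; have ek := xi _ _ zk xz; subst j; subst k.
by have [_ + _] := cl i; apply.
Qed.

End VillaFacts.

End Good.

(** * Villas, mansions and 5-baskets have property (a) *)

Section Good2.
Variables (T : finType) (E : rel T).
Hypotheses (Esym : symmetric E) (Eirr : irreflexive E).
Local Notation R := (radj E).
Local Notation admissible := (admissible E).

Lemma villa_tab_sym k l : villa_tab k l = villa_tab l k.
Proof.
by do 9?[case: k => [|k]]; do 9?[case: l => [|l]]; rewrite /villa_tab /= ?nth_nil.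
Qed.

(** Label 8 lies outside the table, whose default entry 1 makes it adjacent to everything: it is the
    label of universal vertices. *)
Lemma villa_tab8 k : villa_tab k 8 = 1.
Proof. by do 9?[case: k => [|k]]. Qed.

Lemma villa_ttP (t : nat) (Q A : {set T}) (B C : 'I_t -> {set T}) (lb : T -> nat) :
  villa_partition E Q A B C ->
  (forall x, lb x = 1 -> x \in \bigcup_i B i) ->
  (forall x, lb x = 2 -> x \in \bigcup_i C i) ->
  forall x y z, x != y -> x != z -> y != z ->
    villa_tt (lb x) (lb y) (lb z) (E x y) (E x z) (E y z).
Proof.
move=> vp l1 l2.
have close x y z : (lb x == 1) || (lb x == 2) -> lb y == 1 -> lb z == 1 ->
    E x y -> E x z -> y != z -> E y z.
  move=> hx /eqP/l1 hy /eqP/l1 hz; apply: (villa_close Esym vp) => //.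
  by rewrite inE; case/orP: hx => /eqP; [move/l1->|move/l2->; rewrite orbT].
move=> x y z nxy nxz nyz; apply/and3P; split; apply/implyP => /and5P[hx hy hz a b].
- exact: close hx hy hz a b nyz.
- by apply: (close y x z) => //; rewrite Esym.
- by apply: (close z x y) => //; rewrite Esym.
Qed.

Lemma rest_univ (parts : seq {set T}) (Q : {set T}) :
  size parts = 8 -> (forall x, x \in Q -> has (fun S : {set T} => x \in S) parts) ->
  clique E (~: Q) -> complete E (~: Q) Q ->
  forall x y, lab parts x = 8 -> x != y -> E x y.
Proof.
move=> sp hQ cl cm x y x8 nxy.
have xQ : x \in ~: Q.
  rewrite inE; apply/negP => /hQ; rewrite has_find sp => h.
  by have : lab parts x < 8 := h; rewrite x8.
by case: (boolP (y \in Q)) => yQ; [apply: cm | apply: cl; rewrite // inE].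
Qed.

Lemma rest_not_simplicial (Q : {set T}) x y v :
  complete E (~: Q) Q -> x \in Q -> y \in Q -> ~~ R x y -> v \notin Q ->
  ~ simplicial E v.
Proof.
move=> cm xQ yQ nxy vQ; apply: (not_simplicial _ _ nxy); apply: cm => //;
  by rewrite inE.
Qed.

Lemma villa_good (Q : {set T}) :
  is_villa E Q -> clique E (~: Q) -> complete E (~: Q) Q -> admissible Q.
Proof.
case=> t [t3 [A [B [C vp]]]] cl cm.
have [QU [a aA] cls [AB AC] [BB CC BC nest]] := villa_facts vp.
have t0 : 0 < t by apply: leq_trans t3.
have [_ _ [c ci] _] := nest (Ordinal t0).
have aQ : a \in Q by rewrite QU inE aA.
have cQ : c \in Q.
  by rewrite QU !inE; apply/or3P/Or33/bigcupP; exists (Ordinal t0).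
have nac := AC _ _ _ aA ci.
have [a' a'A conn] := villa_connect Esym t3 vp (subxx Q).
split; last 1 first.
- exact: card_gt1 aQ cQ nac.
- pose parts := [:: A; \bigcup_i B i; \bigcup_i C i; set0; set0; set0; set0; set0].
  have entries k l : k <= l < 8 ->
      entry E (villa_tab k l) (nth set0 parts k) (nth set0 parts l).
    case/andP; do 8?[case: k => [|k]]; do 8?[case: l => [|l]] => //= _ _;
      try by move=> x y ?; rewrite inE.
    + by have [+ _ _] := cls (Ordinal t0).
    + by move=> x y xA /bigcupP[i _ yi] _; exact: AB xA yi.
    + by move=> x y xA /bigcupP[i _ yi]; apply/nR_E/(AC i).
    + move=> x y /bigcupP[i _ xi] /bigcupP[j _ yj] nxy.
      have [e|nij] := eqVneq i j; last exact: CC nij xi yj.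
      by subst j; have [_ _ +] := cls i; apply.
  apply: (labelled_fam0 Esym (parts := parts) _ villa_tab_sym villa_tab8 entries _
    _ _ _ _ villa_refute) => //.
  + apply: rest_univ cl cm => // x; rewrite QU !inE /= => /or3P[] ->; by rewrite ?orbT.
  + apply: (villa_ttP vp) => x lx.
      by have := mem_lab (parts := parts) erefl (x := x); rewrite lx => /(_ isT).
    by have := mem_lab (parts := parts) erefl (x := x); rewrite lx => /(_ isT).
  + by move=> x y u w; exact: (villa_cross vp).
- exact: (villa_pentagon Esym Eirr t3 vp).
- move=> v; case: (boolP (v \in Q)) => [vQ|]; first exact: (villa_not_simplicial Esym t3 vp vQ).
  exact: rest_not_simplicial cm aQ cQ nac.
- exact (anticonnected_from Esym conn).
Qed.

(** Most of this is inherited from the villa inside. In the complement F is attached to it through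
    B_j, X through C_j and Y through A. Nonadjacent neighbours are in A and in some C_i with i
    different from j for F, in F and B_j for X, in F and C_j for Y. *)
Lemma mansion_good (Q : {set T}) :
  is_mansion E Q -> clique E (~: Q) -> complete E (~: Q) Q -> admissible Q.
Proof.
case=> t [t3 [A [B [C [F [X [Y [j [[QU pw]]]]]]]]]].
case=> F0 [cF [cX [cY [vp [FA [FB [FC [FBC [BjCj]]]]]]]]].
case=> XAB [XB [XC [FXY [XY [YC YAB]]]]] cl cm.
have [_ [a aA] cls [AB AC] [BB CC BC nest]] := villa_facts vp.
have [dAY dpre _ _ _] := parts_pairwise_inv (pre := [:: A; F; X; Y]) pw.
rewrite !big_cons bigcup_parts in QU.
have [f fF] : exists f, f \in F by case/set0Pn: F0 => f; exists f.
have [[b bj _] _ [c cj] _] := nest j.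
have inU1 (S : 'I_t -> {set T}) x : x \in \bigcup_(i | i != j) S i ->
    exists2 i, i != j & x \in S i by case/bigcupP=> i; exists i.
have inU (S : 'I_t -> {set T}) i x : x \in S i -> x \in \bigcup_i S i.
  by move=> xi; apply/bigcupP; exists i.
have inUj (S : 'I_t -> {set T}) i x : i != j -> x \in S i -> x \in \bigcup_(i | i != j) S i.
  by move=> nij xi; apply/bigcupP; exists i.
have sub1 (S : 'I_t -> {set T}) x : x \in \bigcup_(i | i != j) S i -> x \in \bigcup_i S i.
  by case/bigcupP=> i _; apply: inU.
have nFB x y : x \in F -> y \in B j -> ~~ R x y.
  apply: R_dis; first by move=> u v uF vB; apply: FBC; rewrite // inE vB.
  by have /andP[] : [disjoint F & B j] && [disjoint F & C j] by apply: dpre; rewrite !inE eqxx orbT.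
have nFC x y : x \in F -> y \in C j -> ~~ R x y.
  apply: R_dis; first by move=> u v uF vB; apply: FBC; rewrite // inE vB orbT.
  by have /andP[] : [disjoint F & B j] && [disjoint F & C j] by apply: dpre; rewrite !inE eqxx orbT.
have nXC x y i : x \in X -> y \in C i -> ~~ R x y.
  apply: R_dis; first by move=> u v uX vC; apply: XC uX (inU _ _ _ vC).
  by have /andP[] : [disjoint X & B i] && [disjoint X & C i] by apply: dpre; rewrite !inE eqxx !orbT.
have nYA x y : x \in Y -> y \in A -> ~~ R x y.
  apply: R_dis; first by move=> u v uY vA; apply: YAB; rewrite // inE vA.
  by case/andP: dAY => /and4P[_ _ dAY _] _; rewrite disjoint_sym.
have QE x : (x \in Q) = [|| x \in A, x \in F, x \in X, x \in Y,
    x \in \bigcup_i B i | x \in \bigcup_i C i] by rewrite -QU !inE.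
have aQ : a \in Q by rewrite QE aA.
have cQ : c \in Q by rewrite QE (inU C j c cj) !orbT.
have bQ : b \in Q by rewrite QE (inU B j b bj) !orbT.
have subQ : A :|: \bigcup_i B i :|: \bigcup_i C i \subset Q.
  by apply/subsetP => x; rewrite QE !inE => /orP[/orP[]|] ->; rewrite ?orbT.
have nac := AC _ _ _ aA cj.
have [a' a'A conn] := villa_connect Esym t3 vp subQ.
have a'Q : a' \in Q by rewrite QE a'A.
split; last 1 first.
- exact: card_gt1 aQ cQ nac.
- pose parts := [:: A; \bigcup_(i | i != j) B i; \bigcup_(i | i != j) C i; B j; C j; F; X; Y].
  have Ec (S S' : {set T}) : complete E S S' -> forall x y, x \in S' -> y \in S -> E x y.
    by move=> h x y xS yS; rewrite Esym h.
  have Ea (S S' : {set T}) : anticomplete E S S' -> forall x y, x \in S' -> y \in S -> ~~ E x y.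
    by move=> h x y xS yS; rewrite Esym h.
  have entries k l : k <= l < 8 ->
      entry E (villa_tab k l) (nth set0 parts k) (nth set0 parts l).
    case/andP; do 8?[case: k => [|k]]; do 8?[case: l => [|l]] => //= _ _.
    + by have [+ _ _] := cls j.
    + by move=> x y xA /inU1[i _ yi] _; exact: AB xA yi.
    + by move=> x y xA /inU1[i _ yi]; apply/nR_E/(AC i).
    + by move=> x y xA yj _; exact: AB xA yj.
    + by move=> x y xA yj; apply/nR_E/(AC j).
    + by move=> x y xA yF _; exact: Ec FA _ _ xA yF.
    + by move=> x y xA yX _; apply: Ec XAB _ _ _ yX; rewrite inE xA.
    + by move=> x y xA yY; apply: Ea YAB _ _ _ yY; rewrite inE xA.
    + by move=> x y /inU1[i nij xi] yj; apply/nR_E/(BB i j).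
    + by move=> x y /inU1[i nij xi] yj; apply/nR_E/(BC i j).
    + by move=> x y xB yF _; exact: Ec FB _ _ xB yF.
    + by move=> x y xB yX; exact: Ea XB _ _ xB yX.
    + by move=> x y /sub1 xB yY; apply: Ea YAB _ _ _ yY; rewrite inE xB orbT.
    + move=> x y /inU1[i _ xi] /inU1[k _ yk] nxy.
      have [e|nik] := eqVneq i k; last exact: CC nik xi yk.
      by subst k; have [_ _ +] := cls i; apply.
    + move=> x y /inU1[i nij xi] yj; rewrite Esym; apply/nR_E/(BC j i) => //.
      by rewrite eq_sym.
    + by move=> x y /inU1[i nij xi] yj _; exact: CC nij xi yj.
    + by move=> x y xC yF _; exact: Ec FC _ _ xC yF.
    + by move=> x y /sub1 xC yX; exact: Ea XC _ _ xC yX.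
    + by move=> x y /sub1 xC yY _; exact: Ec YC _ _ xC yY.
    + by have [_ + _] := cls j.
    + by move=> x y xj yj _; exact: BjCj.
    + by move=> x y xj yF; rewrite Esym; apply/nR_E/nFB.
    + by move=> x y xj yX _; apply: Ec XAB _ _ _ yX; rewrite inE xj orbT.
    + by move=> x y /inU xB yY; apply: Ea YAB _ _ _ yY; rewrite inE xB orbT.
    + by have [_ _ +] := cls j.
    + by move=> x y xj yF; rewrite Esym; apply/nR_E/nFC.
    + by move=> x y /inU xC yX; exact: Ea XC _ _ xC yX.
    + by move=> x y /inU xC yY _; exact: Ec YC _ _ xC yY.
    + by move=> x y xF yX _; apply: FXY; rewrite // inE yX.
    + by move=> x y xF yY _; apply: FXY; rewrite // inE yY orbT.
  apply: (labelled_fam0 Esym (parts := parts) _ villa_tab_sym villa_tab8 entries _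
    _ _ _ _ villa_refute) => //.
  + apply: rest_univ cl cm => // x; rewrite QE /= orbF.
    case/or4P=> [->|->|->|/or3P[->|/bigcupP[i _ xi]|/bigcupP[i _ xi]]]; rewrite ?orbT //.
      by have [eij|nij] := eqVneq i j; [rewrite -eij xi | rewrite (inUj B i)]; rewrite ?orbT.
    by have [eij|nij] := eqVneq i j; [rewrite -eij xi | rewrite (inUj C i)]; rewrite ?orbT.
  + apply: (villa_ttP vp) => x lx.
      by have := mem_lab (parts := parts) erefl (x := x); rewrite lx => /(_ isT)/sub1.
    by have := mem_lab (parts := parts) erefl (x := x); rewrite lx => /(_ isT)/sub1.
  + by move=> x y u w /sub1 xB /sub1 yB /sub1 uC /sub1 wC; exact: (villa_cross vp).
- exact: (villa_pentagon Esym Eirr t3 vp).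
- move=> v; case: (boolP (v \in Q)) => [|]; last exact: rest_not_simplicial cm aQ cQ nac.
  have vil u : u \in A :|: \bigcup_i B i :|: \bigcup_i C i -> ~ simplicial E u.
    exact: (villa_not_simplicial Esym t3 vp).
  rewrite QE; case/or4P=> [vA|vF|vX|/or3P[vY|vB|vC]].
  + by apply: vil; rewrite !inE vA.
  + have [i nij] := idx_ne t3 j; have [_ _ [d di] _] := nest i.
    apply: (not_simplicial _ _ (AC _ _ _ aA di)); first exact: FA.
    by apply: FC => //; apply: inUj di; rewrite eq_sym.
  + apply: (not_simplicial _ _ (nFB _ _ fF bj)).
      by rewrite Esym; apply: FXY; rewrite // inE vX.
    by apply: XAB; rewrite // inE bj orbT.
  + apply: (not_simplicial _ _ (nFC _ _ fF cj)).
      by rewrite Esym; apply: FXY; rewrite // inE vY orbT.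
    exact: YC vY (inU _ _ _ cj).
  + by apply: vil; rewrite !inE vB orbT.
  + by apply: vil; rewrite !inE vC orbT.
- apply: (anticonnected_from Esym (a := a')) => x.
  have bc : connect (co E Q) b a' by apply: conn; rewrite !inE (inU B j b bj) orbT.
  have cc : connect (co E Q) c a' by apply: conn; rewrite !inE (inU C j c cj) orbT.
  rewrite QE; case/or4P=> [xA|xF|xX|/or3P[xY|xB|xC]].
  + by apply: conn; rewrite !inE xA.
  + by apply: connect_trans bc; apply: coR bQ (nFB _ _ xF bj); rewrite QE xF !orbT.
  + by apply: connect_trans cc; apply: coR cQ (nXC _ _ _ xX cj); rewrite QE xX !orbT.
  + by apply: coR a'Q (nYA _ _ xY a'A); rewrite QE xY !orbT.
  + by apply: conn; rewrite !inE xB orbT.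
  + by apply: conn; rewrite !inE xC orbT.
Qed.

Lemma ord3_ne (i : 'I_3) : exists k, k != i.
Proof.
have [e|] := eqVneq ord0 i; last by exists ord0.
by exists ord_max; rewrite -e.
Qed.

Lemma ord3_ne2 (i : 'I_3) : exists k l, [/\ k != i, l != i & k != l].
Proof.
exists (inord ((i.+1) %% 3)), (inord ((i.+2) %% 3)).
by rewrite -!val_eqE /= !inordK ?ltn_mod //; case: i => [[|[|[|i]]] hi].
Qed.

Lemma basket_good (Q : {set T}) :
  is_5basket E Q -> clique E (~: Q) -> complete E (~: Q) Q -> admissible Q.
Proof.
case=> A [B [C [F [i [j [[QU pw] [A0 [cA [BCne [cF [BB [CC [AB]]]]]]]]]]]]].
case=> nest [AC [BC [BC' [FQ FBC]]]] cl cm.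
have [dAF dpre dB dC dBC] := parts_pairwise_inv (pre := [:: A; F]) pw.
rewrite !big_cons bigcup_parts in QU.
have QE x : (x \in Q) = [|| x \in A, x \in F, x \in \bigcup_i B i | x \in \bigcup_i C i].
  by rewrite -QU !inE.
have inU (S : 'I_3 -> {set T}) k x : x \in S k -> x \in \bigcup_i S i.
  by move=> xk; apply/bigcupP; exists k.
have bx k : exists b, b \in B k by have [/set0Pn[b]] := BCne k; exists b.
have cx k : exists c, c \in C k by have [_ [_ [/set0Pn[c cc] _]]] := BCne k; exists c.
(* The first vertex [a] of the nested ordering sees all of B_{i*}, hence every B_k. It is the apex
   of the pentagon and the vertex to which all others are linked in the complement. *)
have [[a aA top] cross] := nested_orderingE nest.
have dP P k : P \in [:: A; F] -> [disjoint P & B k] && [disjoint P & C k] by exact: dpre.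
have nAC x y k : x \in A -> y \in C k -> ~~ R x y.
  apply: R_dis; first by move=> u v uA vC; apply: AC uA (inU _ _ _ vC).
  by have /andP[] := dP A k (mem_head _ _).
have nBB k l x y : k != l -> x \in B k -> y \in B l -> ~~ R x y.
  by move=> nkl; apply: R_dis; [apply: BB | apply: dB].
have nBC k l x y : k != l -> x \in B k -> y \in C l -> ~~ R x y.
  by move=> nkl; apply: R_dis; [apply: BC' | apply: dBC].
have nFB x y : x \in F -> y \in B j -> ~~ R x y.
  apply: R_dis; first by move=> u v uF vB; apply: FBC; rewrite // inE vB.
  by have /andP[] : [disjoint F & B j] && [disjoint F & C j] by apply: dP; rewrite !inE eqxx orbT.
have nFC x y : x \in F -> y \in C j -> ~~ E x y.
  by move=> xF yC; apply: FBC; rewrite // inE yC orbT.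
have ABk k x y : k != i -> x \in A -> y \in B k -> E x y.
  move=> nki xA yk; apply: AB => //; rewrite inE (inU _ _ _ yk) andbT.
  by rewrite (disjointFr (dB _ _ nki)).
have aB k y : y \in B k -> E a y.
  by have [-> /top|nki] := eqVneq k i; [|exact: ABk nki aA].
have dAF' : [disjoint F & A] by move: dAF; rewrite /= !andbT disjoint_sym.
have FA x y : x \in F -> y \in A -> E x y.
  move=> xF yA; apply: FQ; rewrite // !inE QE yA andbT.
  have /andP[dab dac] := dP A j (mem_head _ _).
  by rewrite (disjointFr dab) // (disjointFr dac) // (disjointFl dAF').
have notF k x : x \in B k \/ x \in C k -> x \notin F.
  have /andP[db dc] : [disjoint F & B k] && [disjoint F & C k] by apply: dP; rewrite !inE eqxx orbT.
  by case=> xk; apply/negP => xF; [rewrite (disjointFr db) in xk|rewrite (disjointFr dc) in xk].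
have FBk k x y : k != j -> x \in F -> y \in B k -> E x y.
  move=> nkj xF yk; apply: FQ; rewrite // !inE QE (inU _ _ _ yk) !orbT andbT.
  rewrite (disjointFr (dB _ _ nkj)) // (disjointFr (dBC k j)) //=.
  by apply: (notF k); left.
have FCk k x y : k != j -> x \in F -> y \in C k -> E x y.
  move=> nkj xF yk; apply: FQ; rewrite // !inE QE (inU _ _ _ yk) !orbT andbT.
  rewrite (disjointFr (dC _ _ nkj)) // (disjointFl (dBC j k)) //=.
  by apply: (notF k); right.
have aQ : a \in Q by rewrite QE aA.
have BQ k x : x \in B k -> x \in Q by move=> xk; rewrite QE (inU _ _ _ xk) !orbT.
have CQ k x : x \in C k -> x \in Q by move=> xk; rewrite QE (inU _ _ _ xk) !orbT.
have [c0 c0C] := cx ord0.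
have nac := nAC _ _ _ aA c0C.
split; last 1 first.
- exact: card_gt1 aQ (CQ _ _ c0C) nac.
- pose o k : 'I_3 := inord k.
  have no k l : k < 3 -> l < 3 -> k != l -> o k != o l.
    by move=> k3 l3; apply: contraNneq => /(congr1 val) /=; rewrite !inordK // => ->.
  have oE (k : 'I_3) : o k = k by rewrite /o inord_val.
  have oi k : k < 3 -> (o k == i) = (k == i :> nat) by move=> k3; rewrite -val_eqE /= inordK.
  have oj k : k < 3 -> (o k == j) = (k == j :> nat) by move=> k3; rewrite -val_eqE /= inordK.
  pose parts := [:: A; B (o 0); B (o 1); B (o 2); C (o 0); C (o 1); C (o 2); F].
  have eAB k : k < 3 -> entry E (if k == i :> nat then 2 else 1) A (B (o k)).
    move=> k3; case: ifP => // nki x y xA yk _; apply: (ABk (o k)) => //.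
    by rewrite oi // nki.
  have eBF k : k < 3 -> entry E (k != j :> nat) (B (o k)) F.
    move=> k3; rewrite -oj //; have [->|nkj] := eqVneq (o k) j => /= x y xk yF.
      by rewrite Esym; apply/nR_E/nFB.
    by rewrite Esym (FBk (o k)).
  have eCF k : k < 3 -> entry E (k != j :> nat) (C (o k)) F.
    move=> k3; rewrite -oj //; have [->|nkj] := eqVneq (o k) j => /= x y xk yF.
      by rewrite Esym; apply/nFC.
    by rewrite Esym (FCk (o k)).
  have eBB k l : k < 3 -> l < 3 -> k != l -> anticomplete E (B (o k)) (B (o l)).
    by move=> k3 l3 nkl; apply/BB/no.
  have eCC k l : k < 3 -> l < 3 -> entry E 1 (C (o k)) (C (o l)).
    move=> k3 l3 x y xk yl nxy; have [e|nkl] := eqVneq (o k) (o l).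
      by rewrite e in xk; have [_ [_ [_ +]]] := BCne (o l); apply.
    exact: CC nkl _ _ xk yl.
  have eBC k l : k < 3 -> l < 3 -> entry E (k == l) (B (o k)) (C (o l)).
    move=> k3 l3; have [->|nkl] := eqVneq k l => /= x y xk yl; first by move=> _; apply: (BC (o l)).
    by apply/nR_E/(nBC (o k) (o l)); rewrite ?no.
  have eB k : k < 3 -> entry E 1 (B (o k)) (B (o k)).
    by move=> _ x y xk yk; have [_ [+ _]] := BCne (o k); apply.
  have entries k l : k <= l < 8 ->
      entry E (basket_tab i j k l) (nth set0 parts k) (nth set0 parts l).
    case/andP; do 8?[case: k => [|k]]; do 8?[case: l => [|l]] => // _ _;
      rewrite /basket_tab [nth _ _ _]/=.
    all: try (exact: eAB).
    all: try (exact: eBF).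
    all: try (exact: eCF).
    all: try (exact: eBB).
    all: try (exact: eCC).
    all: try (exact: (eBC 0 0)); try (exact: (eBC 0 1)); try (exact: (eBC 0 2)).
    all: try (exact: (eBC 1 0)); try (exact: (eBC 1 1)); try (exact: (eBC 1 2)).
    all: try (exact: (eBC 2 0)); try (exact: (eBC 2 1)); try (exact: (eBC 2 2)).
    all: try (exact: eB).
    all: try (exact: cA); try (exact: cF).
    all: try (by move=> x y xA yk; apply/nR_E; exact: nAC xA yk).
    by move=> x y xA yF _; rewrite Esym FA.
  have tsym k l : basket_tab i j k l = basket_tab i j l k.
    by do 8?[case: k => [|k]]; do 8?[case: l => [|l]]; rewrite /basket_tab /= ?nth_nil.
  have t8 k : basket_tab i j k 8 = 1 by do 8?[case: k => [|k]]; rewrite /basket_tab /= ?nth_nil.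
  have pB : nth set0 parts i.+1 = B i.
    by rewrite -[in RHS](oE i); case: (i) => [[|[|[|m]]] hm].
  apply: (labelled_fam0 Esym (parts := parts) _ tsym t8 entries _
    _ _ _ _ (basket_refute i j)) => //.
  + apply: rest_univ cl cm => // x; rewrite QE /= orbF.
    have bo k : k = o 0 \/ k = o 1 \/ k = o 2.
      by rewrite -(oE k); case: k => [[|[|[|k]]] hk]; auto.
    case/or4P=> [->|->|/bigcupP[k _ xk]|/bigcupP[k _ xk]]; rewrite ?orbT //.
      by have [e|[e|e]] := bo k; subst k; rewrite xk ?orbT.
    by have [e|[e|e]] := bo k; subst k; rewrite xk ?orbT.
  + by move=> x y u w xA yA; rewrite pB => ui wi _ _; exact: cross.
  + exact: (leq_ltn_trans (ltn_ord i)).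
- pose b k := xchoose (bx k); pose c k := xchoose (cx k).
  have bB k : b k \in B k by exact: xchooseP (bx k).
  have cC k : c k \in C k by exact: xchooseP (cx k).
  apply: (@pentagonP _ _ Esym Eirr a b c) => [k|k|k|k l n|k l n|k l n].
  + exact: aB (bB k).
  + exact: nAC aA (cC k).
  + exact: BC (bB k) (cC k).
  + exact: nBB n (bB k) (bB l).
  + exact: CC n _ _ (cC k) (cC l).
  + exact: nBC n (bB k) (cC l).
- move=> v; case: (boolP (v \in Q)) => [|]; last exact: rest_not_simplicial cm aQ (CQ _ _ c0C) nac.
  rewrite QE; case/or4P=> [vA|vF|/bigcupP[k _ vk]|/bigcupP[k _ vk]].
  + have [k [l [ki li kl]]] := ord3_ne2 i.
    have [x xk] := bx k; have [y yl] := bx l.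
    exact: (not_simplicial (ABk _ _ _ ki vA xk) (ABk _ _ _ li vA yl) (nBB _ _ _ _ kl xk yl)).
  + have [k kj] := ord3_ne j; have [y yk] := cx k.
    exact: (not_simplicial (FA _ _ vF aA) (FCk _ _ _ kj vF yk) (nAC _ _ _ aA yk)).
  + have [y yk] := cx k.
    apply: (not_simplicial _ (BC _ _ _ vk yk) (nAC _ _ _ aA yk)).
    by rewrite Esym; exact: aB vk.
  + have [l lk] := ord3_ne k; have [x xk] := bx k; have [y yl] := cx l.
    apply: (@not_simplicial _ _ v x y).
    * by rewrite Esym; exact: BC xk vk.
    * by rewrite eq_sym in lk; exact: CC lk _ _ vk yl.
    * by rewrite eq_sym in lk; exact: nBC lk xk yl.
- have ca k x : x \in C k -> connect (co E Q) x a.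
    by move=> xk; apply: coR (CQ _ _ xk) aQ _; rewrite Rsym // (nAC _ _ k).
  have ba k x : x \in B k -> connect (co E Q) x a.
    move=> xk; have [l lk] := ord3_ne k; have [y yl] := cx l.
    rewrite eq_sym in lk; apply: connect_trans (ca _ _ yl).
    exact: coR (BQ _ _ xk) (CQ _ _ yl) (nBC _ _ _ _ lk xk yl).
  apply: (anticonnected_from Esym (a := a)) => x.
  move=> xQ; have := xQ; rewrite QE; case/or4P=> [xA|xF|/bigcupP[k _ xk]|/bigcupP[k _ xk]].
  + by apply: connect_trans (ca _ _ c0C); exact: coR xQ (CQ _ _ c0C) (nAC _ _ _ xA c0C).
  + have [y yj] := bx j; apply: connect_trans (ba _ _ yj).
    exact: coR xQ (BQ _ _ yj) (nFB _ _ xF yj).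
  + exact: ba xk.
  + exact: ca xk.
Qed.

End Good2.

(** * Anticomponents *)

Section Final.
Variables (T : finType) (E : rel T).
Hypotheses (Esym : symmetric E) (Eirr : irreflexive E).
Local Notation R := (radj E).

Lemma has_induced_dec n (eS : rel 'I_n) : has_induced E eS \/ ~ has_induced E eS.
Proof.
have [/existsP[f /andP[/injectiveP injf /'forall_'forall_eqP Ef]]|/existsPn no] :=
    boolP [exists f : {ffun 'I_n -> T},
      injectiveb f && [forall x, forall y, E (f x) (f y) == eS x y]].
  by left; exists f.
right=> -[f [injf Ef]]; case/negP: (no (finfun f)); apply/andP; split.
  by apply/injectiveP => x y; rewrite !ffunE => /injf.
by apply/'forall_'forall_eqP => x y; rewrite !ffunE.
Qed.

Lemma pattern_extension (p : pattern) (r : bitseq) :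
  rows_of p = rcons Pm r -> has_induced E (graph_of_edges p.1 p.2) ->
  exists vs z, mat E [::] vs = Pm /\ [seq R z v | v <- vs] = r.
Proof.
move=> hr /induced_mat [] // ws; rewrite hr; case/lastP: ws => [|vs z].
  by move/(congr1 size); rewrite size_rcons.
rewrite -cats1 mat_cat cats1 => /rcons_inj [e1 e2].
by exists vs, z.
Qed.

(** A copy of [patA], [patD] or [patF] brings its own pentagon, around which the extra vertex has
    index 1. If there is no copy, that kind is therefore impossible for every pentagon and every
    index. *)
Lemma structure_exists :
  (forall p, p \in fam0 -> omits E p) -> has_induced E pentagon3 ->
  (forall v, ~ simplicial E v) ->
  exists Q : {set T}, (is_5basket E Q \/ is_villa E Q \/ is_mansion E Q) /\
    clique E (~: Q) /\ complete E (~: Q) Q.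
Proof.
move=> om hP ns.
have om0 : omits_all E fam0.
  move=> p hp; split; last exact: om.
  by have : all proper_pattern fam0 by [vm_compute]; move/allP; apply.
have ext (p : pattern) r k :
    rows_of p = rcons Pm r -> code k = r -> has_induced E (graph_of_edges p.1 p.2) ->
    exists (x0 : T) vs z, mat E [::] vs = Pm /\ kd E vs z = k.
  move=> hr ck /(pattern_extension hr)[vs [z [hv tz]]]; exists z, vs, z; split=> //.
  have : code (kd E vs z) = code k by rewrite ck -tz (code_kd Esym Eirr om0 z).
  case: (kd E vs z) => [||[]|[]|[]||[]|[]|[]|[]|[]||[]|];
    by case: k {ck} => [||[]|[]|[]||[]|[]|[]|[]|[]||[]|].
have [hA|nA] := has_induced_dec (graph_of_edges patA.1 patA.2).
  have [x0 [vs [z [hv kz]]]] := ext patA _ (KAk I0) erefl erefl hA.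
  have [Q [hQ rest]] := basket_case Esym Eirr om0 ns x0 hv (or_introl kz).
  by exists Q; split; [left|].
have [hD|nD] := has_induced_dec (graph_of_edges patD.1 patD.2).
  have [x0 [vs [z [hv kz]]]] := ext patD _ (KD I0) erefl erefl hD.
  have [Q [hQ rest]] := basket_case Esym Eirr om0 ns x0 hv (or_intror kz).
  by exists Q; split; [left|].
have omM : omits_all E famM.
  move=> p; rewrite /famM 2!in_cons => /or3P[/eqP->|/eqP->|]; [by split|by split|].
  exact: om0.
have [hF|nF] := has_induced_dec (graph_of_edges patF.1 patF.2).
  have [x0 [vs [z [hv kz]]]] := ext patF _ (KF I0) erefl erefl hF.
  have [Q [hQ rest]] := @mansion_case _ _ Esym Eirr om0 omM ns x0 vs hv true z (fun _ => kz)
    (fun h => False_ind _ (notF h)) isT.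
  by exists Q; split; [right; right|].
have omV : omits_all E famV.
  by move=> p; rewrite /famV in_cons => /orP[/eqP->|/omM].
have [vs hv] := @induced_mat _ _ patP3 hP.
have [x0 _] : exists x0 : T, True by case: hP => f _; exists (f ord0).
have [Q [hQ rest]] := @villa_case _ _ Esym Eirr om0 omM ns x0 vs hv false x0
  (fun h => False_ind _ (notF h)) (fun _ => omV) isT.
by exists Q; split; [right; left|].
Qed.

Lemma structure_good (Q : {set T}) :
  is_5basket E Q \/ is_villa E Q \/ is_mansion E Q ->
  clique E (~: Q) -> complete E (~: Q) Q -> admissible E Q.
Proof.
by case=> [|[]] h cl cm; [apply: basket_good|apply: villa_good|apply: mansion_good].
Qed.

Lemma universal_connect (S : {set T}) u v :
  (forall w, u != w -> E u w) -> connect (co E S) u v -> u = v.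
Proof.
move=> uu /connectP[[|w p] /=]; first by move=> _ ->.
by case/andP=> /and4P[_ _ nuw nE] _ _; rewrite uu in nE.
Qed.

Lemma rest_universal (Q : {set T}) u :
  clique E (~: Q) -> complete E (~: Q) Q -> u \notin Q ->
  forall w, u != w -> E u w.
Proof.
move=> cl cm uQ w nuw; have [wQ|wQ] := boolP (w \in Q).
  by apply: cm; rewrite // inE.
by apply: cl; rewrite // inE.
Qed.

(** A universal vertex is isolated in the complement, so an anticonnected set with two vertices
    contains none and meets [Q]. The union of an anticomponent with [Q] is then anticonnected, and
    maximality on both sides makes them equal. *)
Lemma only_anticomponent (Q : {set T}) :
  anticonnected E Q -> 1 < #|Q| -> clique E (~: Q) -> complete E (~: Q) Q ->
  anticomponent E Q /\
  forall Y : {set T}, anticomponent E Y -> 1 < #|Y| -> Y = Q.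
Proof.
move=> aQ Q1 cl cm; have uni := rest_universal cl cm.
have [q qQ] : exists q, q \in Q by apply/card_gt0P; apply: ltnW.
have maxQ (Y : {set T}) : Q \subset Y -> anticonnected E Y -> Y = Q.
  move=> QY aY; apply/eqP; rewrite eqEsubset QY andbT; apply/subsetP => y yY.
  apply: contraT => yQ; have := aY y q yY (subsetP QY _ qQ).
  by move/(universal_connect (uni _ yQ)) => e; rewrite e qQ in yQ.
split; first by split; [apply/set0Pn; exists q|].
move=> Y [_ [aY maxY]] /card_gt1P[u [v [uY vY nuv]]].
have [/existsP[y /andP[yY yQ]]|/existsPn dis] := boolP [exists y, (y \in Y) && (y \in Q)].
  have sub (S S' : {set T}) x z : S \subset S' -> connect (co E S) x z -> connect (co E S') x z.
    move=> /subsetP SS; apply: connect_sub => a b /and4P[aS bS nab nE].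
    by apply: connect1; rewrite /co !SS // nab.
  have toy x : x \in Y :|: Q -> connect (co E (Y :|: Q)) x y.
    rewrite inE => /orP[xY|xQ].
      exact: sub (subsetUl _ _) (aY _ _ xY yY).
    exact: sub (subsetUr _ _) (aQ _ _ xQ yQ).
  have aU := anticonnected_from Esym toy.
  have eY := maxY _ (subsetUl _ _) aU.
  by apply: maxQ => //; rewrite -eY subsetUr.
have uQ : u \notin Q by have := dis u; rewrite uY.
have := universal_connect (uni _ uQ) (aY _ _ uY vY).
by move/eqP; rewrite (negbTE nuv).
Qed.

(** Two distinct nonadjacent vertices form an anticonnected set; a maximal anticonnected set
    containing them is a nontrivial anticomponent, hence [X]. *)
Lemma only_anticomponent_universal (X : {set T}) :
  (forall Y : {set T}, anticomponent E Y -> 1 < #|Y| -> Y = X) ->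
  forall u v, u \notin X -> u != v -> E u v.
Proof.
move=> only u v uX nuv; apply: contraT => nE.
pose ac (S : {set T}) := [forall x in S, forall y in S, connect (co E S) x y].
have acP (S : {set T}) : reflect (anticonnected E S) (ac S).
  apply: (iffP forall_inP) => [h x y xS yS|h x xS].
    by have /forall_inP := h x xS; apply.
  by apply/forall_inP => y yS; exact: h.
have ac2 : ac [set u; v].
  apply/acP; apply: (anticonnected_from Esym (a := v)) => x; rewrite !inE.
  case/orP=> /eqP->; last exact: connect0.
  by apply: connect1; rewrite /co !inE !eqxx orbT nuv.
have [Y /maxsetP[aY maxY] sub] := maxset_exists ac2.
have uY : u \in Y by apply: (subsetP sub); rewrite !inE eqxx.
have vY : v \in Y by apply: (subsetP sub); rewrite !inE eqxx orbT.
have e : Y = X.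
  apply: only; last by apply/card_gt1P; exists u, v.
  split; first by apply/set0Pn; exists u.
  by split; [apply/acP | move=> Z YZ /acP aZ; exact: maxY].
by rewrite -e uY in uX.
Qed.

End Final.

Theorem theorem5p7 (T : finType) (E : rel T)
  (Esym : symmetric E) (Eirr : irreflexive E) (Tne : 0 < #|T|) :
  let a :=
    ~ has_induced E twoP3 /\ ~ has_induced E C4 /\ ~ has_induced E C6 /\
    ~ has_induced E C7 /\ ~ has_induced E T0 /\
    has_induced E pentagon3 /\ (forall v : T, ~ simplicial E v) in
  let b :=
    exists X : {set T},
      (anticomponent E X /\ 1 < #|X|) /\
      (forall Y : {set T}, anticomponent E Y -> 1 < #|Y| -> Y = X) /\
      (is_5basket E X \/ is_villa E X \/ is_mansion E X) in
  let c :=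
    exists Q : {set T},
      (is_5basket E Q \/ is_villa E Q \/ is_mansion E Q) /\
      clique E (~: Q) /\ complete E (~: Q) Q in
  (a <-> b) /\ (b <-> c).
Proof.
move=> a b c.
have ac : a -> c.
  case=> n2 [n4 [n6 [n7 [nT [hP ns]]]]]; apply: (structure_exists Esym Eirr _ hP ns) => p.
  by rewrite !inE => /orP[/eqP->|/or4P[] /eqP->].
have ca : c -> a.
  case=> Q [hQ [cl cm]]; have [om hP ns _ _] := structure_good Esym Eirr hQ cl cm.
  split; first exact: (om pat2P3).
  split; first exact: (om patC4).
  split; first exact: (om patC6).
  split; first exact: (om patC7).
  by split; first exact: (om patT0).
have cb : c -> b.
  case=> Q [hQ [cl cm]]; have [_ _ _ aQ Q1] := structure_good Esym Eirr hQ cl cm.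
  by have [acQ only] := only_anticomponent Esym aQ Q1 cl cm; exists Q.
have bc : b -> c.
  case=> X [_ [only hX]]; exists X; split=> //.
  have uni := only_anticomponent_universal Esym only.
  split=> [x y|x y]; rewrite !inE => xX yX; first exact: uni.
  by apply: uni => //; apply: contraNneq xX => ->.
by split; [split=> [/ac/cb|/bc/ca]|split=> [/bc|/cb]].
Qed.
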